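(* Let $d \geq 2$ and $m \geq 3$ be integers and let $D \subset \mathbb{R}^d$ be a bounded connected open set of class $C^m$. The set of domains $\Omega \in \mathcal{O}^m(D)$ whose boundary $\partial\Omega$ is a real-analytic hypersurface of $\mathbb{R}^d$ is meager in $\mathcal{O}^m(D)$.
   Context: For a vector field $f$ of class $C^m$ on $\mathbb{R}^d$ put $\|f\|_{C^m} := \sum_{|\alpha|\le m} \sup_{x\in\mathbb{R}^d} |\partial^\alpha f(x)|$. Let $C^m_0(\mathbb{R}^d,\mathbb{R}^d)$ be the space of $C^m$ vector fields on $\mathbb{R}^d$ that vanish at infinity for the $C^m$ norm (all derivatives of order at most $m$ tend to $0$ at infinity). Let $\mathrm{Diff}^m_0(\mathbb{R}^d)$ be the group of $C^m$-diffeomorphisms $f$ of $\mathbb{R}^d$ with $f-\mathrm{id} \in C^m_0(\mathbb{R}^d,\mathbb{R}^d)$. Define $\mathcal{O}^m(D) := \{ f(D) : f \in \mathrm{Diff}^m_0(\mathbb{R}^d)\}$, endowed with the Courant--Micheletti distance $$d(\Omega_1,\Omega_2) := \inf \Bigl\{ \sum_{i=1}^N \bigl(\|f_i-\mathrm{id}\|_{C^m} + \|f_i^{-1}-\mathrm{id}\|_{C^m}\bigr) : N\ge 1,\ f_i \in \mathrm{Diff}^m_0(\mathbb{R}^d),\ f_N\circ\cdots\circ f_1(\Omega_1)=\Omega_2 \Bigr\},$$ for which it is a complete separable metric space. A real-analytic hypersurface is an embedded real-analytic submanifold of dimension $d-1$. A subset of a topological space is meager if it is a countable union of nowhere dense sets.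 *)

(* Defs.v *)
(* R^d is 'rV[R]_d, with its canonical (product) topology. *)
From HB Require Import structures.
From mathcomp Require Import all_boot all_order all_algebra finmap.
From mathcomp Require Import all_classical all_reals all_analysis.
From mathcomp.analysis.showcase Require Import summability.
Import Order.TTheory GRing.Theory Num.Theory numFieldNormedType.Exports.

Set Implicit Arguments.
Unset Strict Implicit.
Unset Printing Implicit Defensive.

Local Open Scope classical_set_scope.
Local Open Scope ring_scope.

Section Topology.
Variable T : topologicalType.

Definition frontier (A : set T) : set T := closure A `\` A°.

Definition nowhere_dense (A : set T) : Prop := (closure A)° = set0.

Definition meager (A : set T) : Prop :=
  exists2 F : nat -> set T,
    (forall n, nowhere_dense (F n)) & A = \bigcup_n F n.

End Topology.

Section Regularity.
Variables (R : realType) (d : nat).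
Notation E := 'rV[R]_d.
Implicit Types (f g : E -> E) (U V : set E).

(* The canonical norm of 'rV[R]_d is the maximum norm. *)
Definition euclidean_norm (v : E) : R := Num.sqrt (\sum_i v 0 i ^+ 2).

Definition pderiv (i : 'I_d) f : E -> E := 'D_(delta_mx 0 i) f.

Definition iter_pderiv (s : seq 'I_d) f : E -> E := foldr pderiv f s.

(* The order of differentiation in [mderiv] is irrelevant for the functions it
   is applied to, which are of class C^m with m >= |alpha|. *)
Definition mderiv (alpha : 'I_d -> nat) f : E -> E :=
  foldr (fun i => iter (alpha i) (pderiv i)) f (enum 'I_d).

(* f is of class C^m on the open set U: its iterated partial derivatives of
   order at most m, taken in any order, exist and are continuous on U. *)
Definition Cm_on (m : nat) U f : Prop :=
  forall s : seq 'I_d, (size s <= m)%N -> forall x, U x ->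
    {for x, continuous (iter_pderiv s f)} /\
    ((size s < m)%N ->
     forall i : 'I_d, derivable (iter_pderiv s f) x (delta_mx 0 i)).

Definition vanishes_at_infinity f : Prop :=
  forall e : R, 0 < e -> exists A : R, forall x, A < `|x| -> `|f x| < e.

Definition Cm0 (m : nat) f : Prop :=
  Cm_on m setT f /\
  forall alpha : 'I_d -> nat, (\sum_i alpha i <= m)%N ->
    vanishes_at_infinity (mderiv alpha f).

(* A multi-index of length at most m has all its entries at most m, hence the
   finite index type. *)
Definition Cm_norm (m : nat) f : \bar R :=
  (\sum_(alpha : {ffun 'I_d -> 'I_m.+1} | (\sum_i alpha i <= m)%N)
     ereal_sup (range (fun x =>
       (euclidean_norm (mderiv (fun i => alpha i : nat) f x))%:E)))%E.

(* Every point of U is the centre of a cube on which f is the sum of a power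
   series in d variables.  Convergence along [totally], the filter of finite
   sets of multi-indices, is unconditional, i.e. absolute, convergence. *)
Definition analytic_on U f : Prop :=
  forall a, U a ->
    exists (c : {ffun 'I_d -> nat} -> E) (r : R), 0 < r /\
      forall x, ball a r x ->
        partial_sum (fun alpha : {ffun 'I_d -> nat} =>
            (\prod_i (x 0 i - a 0 i) ^+ alpha i) *: c alpha) @ totally
          --> f x.

(* f restricts to a bijection from the open set U onto the open set V, with
   inverse g, and both are of the regularity described by [regular]. *)
Definition local_diffeo (regular : set E -> (E -> E) -> Prop) U V f g : Prop :=
  [/\ open U, open V, f @` U = V, (forall x, U x -> g (f x) = x) &
      regular U f /\ regular V g].

(* The open set D lies, near each of its boundary points and up to a C^m
   diffeomorphism, on one side of a coordinate hyperplane. *)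
Definition of_class_Cm (m : nat) (D : set E) : Prop :=
  forall p, frontier D p ->
    exists (U V : set E) (f g : E -> E) (i : 'I_d),
      [/\ local_diffeo (Cm_on m) U V f g, U p,
          f @` (U `&` D) = V `&` [set y | 0 < y 0 i] &
          f @` (U `&` frontier D) = V `&` [set y | y 0 i = 0]].

(* Embedded real-analytic submanifold of dimension d - 1. *)
Definition analytic_hypersurface (S : set E) : Prop :=
  forall p, S p ->
    exists (U V : set E) (f g : E -> E) (i : 'I_d),
      [/\ local_diffeo analytic_on U V f g, U p &
          f @` (U `&` S) = V `&` [set y | y 0 i = 0]].

End Regularity.

Section CourantMicheletti.
Variables (R : realType) (d m : nat).
Notation E := 'rV[R]_d.

(* An element of Diff^m_0(R^d), bundled with its inverse. *)
Record diff0 := Diff0 {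
  diff0_fun :> E -> E;
  diff0_inv : E -> E;
  diff0_funK : cancel diff0_fun diff0_inv;
  diff0_invK : cancel diff0_inv diff0_fun;
  diff0_funC : Cm_on m setT diff0_fun;
  diff0_invC : Cm_on m setT diff0_inv;
  diff0_Cm0 : Cm0 m (fun x => diff0_fun x - x) }.

Definition orbit0 (D : set E) : set (set E) :=
  [set Omega | exists f : diff0, Omega = f @` D].

(* [comp_all [:: f_1; ...; f_N]] is f_N \o ... \o f_1. *)
Definition comp_all (s : seq diff0) : E -> E :=
  foldl (fun (h : E -> E) (f : diff0) => f \o h) id s.

Definition cm_cost (s : seq diff0) : \bar R :=
  (\sum_(f <- s) (Cm_norm m (fun x => (f x - x)%R) +
                  Cm_norm m (fun x => (diff0_inv f x - x)%R)))%E.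

Definition cm_dist (Omega1 Omega2 : set E) : \bar R :=
  ereal_inf [set cm_cost s |
    s in [set s | (1 <= size s)%N /\ comp_all s @` Omega1 = Omega2]].

Definition orbit_space (D : set E) : Type :=
  {Omega : set E | orbit0 D Omega}.

HB.instance Definition _ D := gen_eqMixin (orbit_space D).
HB.instance Definition _ D := gen_choiceMixin (orbit_space D).

(* The open sets of the metric topology of [cm_dist]. *)
Definition cm_open (D : set E) : set (set (orbit_space D)) :=
  [set A | forall Omega, A Omega -> exists2 e : R, 0 < e &
     forall Omega' : orbit_space D,
       (cm_dist (sval Omega) (sval Omega') < e%:E)%E -> A Omega'].

Lemma cm_openT D : cm_open (D := D) setT.
Proof. by move=> Omega _; exists 1. Qed.

Lemma cm_openI D : setI_closed (cm_open (D := D)).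
Proof.
move=> A B oA oB Omega [/oA[e1 e1_gt0 sA] /oB[e2 e2_gt0 sB]].
exists (Num.min e1 e2); first by rewrite lt_min e1_gt0.
move=> Omega' lt_e; split; [apply: sA | apply: sB];
  by apply: lt_le_trans lt_e _; rewrite lee_fin ge_min lexx ?orbT.
Qed.

Lemma cm_open_bigU D (I : Type) (F : I -> set (orbit_space D)) :
  (forall i, cm_open (F i)) -> cm_open (\bigcup_i F i).
Proof.
move=> oF Omega [i _ /oF[e e_gt0 sF]].
by exists e => // Omega' /sF FOmega'; exists i.
Qed.

HB.instance Definition _ D := isOpenTopological.Build (orbit_space D)
  (@cm_openT D) (@cm_openI D) (@cm_open_bigU D).

End CourantMicheletti.

(* Main.v *)
(* If the boundary of a domain is real analytic near a point p, it is there the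
   zero set of a function u, strictly monotone along some e_a, and u o c is
   analytic for every polynomial curve c: hence u(c(h)) is, up to O(h^(m+1)),
   the value extrapolated from u(c(0)), u(c(-h)), ..., u(c(-m h)).  Bounding all
   the constants by rational data splits the set of analytic domains into
   countably many pieces, on each of which one fixed scale works.  A piece is
   nowhere dense: shear a domain of the piece by x + e psi(x) e_a, where psi has
   a one-sided singularity of order m + 1/2 at p.  The sheared boundary misses
   the extrapolated value by about h^(m+1/2), and so, at a fixed small h, does
   the boundary of every domain close to the sheared one. *)
From HB Require Import structures.
Require Import Defs.
From mathcomp Require Import all_boot all_order all_algebra finmap.
From mathcomp Require Import all_classical all_reals all_analysis.
From mathcomp Require Import ring lra.
From mathcomp.analysis.showcase Require Import summability.
Import Order.TTheory GRing.Theory Num.Theory numFieldNormedType.Exports.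

Set Implicit Arguments.
Unset Strict Implicit.
Unset Printing Implicit Defensive.

Local Open Scope classical_set_scope.
Local Open Scope ring_scope.

(** The equation [u] varies from domain to domain, and two such equations cannot be compared, so a
    piece records only numbers. Every estimate on [u] is therefore an inequality between values at
    points, with one constant for all polynomial curves of bounded coefficients; it can then be
    applied to the equation of an unknown nearby domain, tested on a curve coming from the domain
    that is sheared. This curve must follow the original boundary up to O(t^(m+1)), which is the
    second datum of a piece; it exists because d >= 2. As psi vanishes on the side of negative
    times, the shear fixes the nodes of the extrapolation and moves only the extrapolated point,
    along e_a; monotonicity of [u] in that direction makes the displacement visible. The exponent m
    + 1/2 is large enough for psi to be C^m, so that the sheared domain stays in the orbit, and
    smaller than the order m + 1 of the error. Closeness of two domains is used as uniform closeness
    to the identity of a map between them, within h^(m+1) at the fixed scale h. *)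

Section Euclid.
Context {R : realType} {d : nat}.
Notation E := 'rV[R]_d.
Notation e_ i := (delta_mx 0 i : E).

(** * Differential calculus on row vectors and families of C^k functions *)

Lemma le_coord_norm (x : E) i : `|x 0 i| <= `|x|.
Proof.
by rewrite [leRHS]/Num.norm/= mx_normrE; apply: (le_bigmax _ (fun ij => `|x ij.1 ij.2|) (0, i)).
Qed.

Lemma row_norm_le (x : E) (M : R) : 0 <= M -> (forall i, `|x 0 i| <= M) -> `|x| <= M.
Proof.
move=> M0 xM; rewrite [leLHS]/Num.norm/= mx_normrE; apply: bigmax_le => //= -[i j] _.
by rewrite ord1.
Qed.

Lemma row_norm_lt (x : E) (M : R) : 0 < M -> (forall i, `|x 0 i| < M) -> `|x| < M.
Proof.
move=> M0 xM; rewrite [ltLHS]/Num.norm/= mx_normrE; apply: bigmax_lt => //= -[i j] _.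
by rewrite ord1.
Qed.

Lemma norm_delta (i : 'I_d) : `|e_ i| = 1.
Proof.
apply/eqP; rewrite eq_le row_norm_le//=.
  by have := le_coord_norm (e_ i) i; rewrite mxE !eqxx normr1.
by move=> j; rewrite mxE eqxx/=; case: eqP; rewrite /= ?normr1 ?normr0.
Qed.

(** The explicit form suits maps known only through an implicit equation, such as the inverse of a
    shear: differentiability and the partial derivatives come out together. *)
Lemma differentiable_gradP (H : E -> R) (x : E) (G : 'I_d -> R) :
  (forall e : R, 0 < e -> exists2 r, 0 < r & forall h : E, `|h| < r ->
     `|H (h + x) - H x - \sum_i h 0 i * G i| <= e * `|h|) ->
  differentiable H x /\ forall i, 'D_(e_ i) H x = G i.
Proof.
move=> HG; pose l (h : E) : R := \sum_i h 0 i * G i.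
have lin_l : linear l.
  move=> a u v; rewrite /l scaler_sumr -big_split/=; apply: eq_bigr => i _.
  by rewrite !mxE mulrDl /GRing.scale/= mulrA.
pose lM := GRing.isLinear.Build _ _ _ _ _ lin_l.
pose L : {linear _ -> _} := HB.pack l lM.
have lc : continuous (L : E -> R).
  apply: (@continuous_big R _ +%R 0 predT (@add_continuous R) E (index_enum _)
    (fun i (h : E) => h 0 i * G i)).
  move=> i _ y; apply: (@continuousM _ _ (fun h : E => h 0 i) (fun=> G i)).
    exact: coord_continuous.
  exact: cst_continuous.
have dE : 'd H x = L :> (E -> R).
  apply: (diff_unique lc); apply/eqaddoP => e e0; have [r r0 Hr] := HG e e0.
  have : \forall h \near (0 : E), `|h| < r by exact: nbhs0_lt.
  by apply: filterS => h /Hr; rewrite -/(l h) -addrA -opprD.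
have dH : differentiable H x.
  apply/diff_locallyP; split; first by rewrite dE.
  apply/eqaddoP => e e0; have [r r0 Hr] := HG e e0.
  have : \forall h \near (0 : E), `|h| < r by exact: nbhs0_lt.
  by apply: filterS => h /Hr; rewrite dE -/(l h) -addrA -opprD.
split=> // i; rewrite deriveE // dE -[LHS]/(l _) /l (bigD1 i)//= big1 => [|j ji].
  by rewrite mxE !eqxx mul1r addr0.
by rewrite mxE eqxx/= (negbTE ji) mul0r.
Qed.

Lemma differentiable_grad (H : E -> R) (x : E) : differentiable H x ->
  forall e : R, 0 < e -> exists2 r, 0 < r & forall h : E, `|h| < r ->
     `|H (h + x) - H x - \sum_i h 0 i * 'D_(e_ i) H x| <= e * `|h|.
Proof.
move=> dH e e0; have [_ /eqaddoP/(_ e e0)] := (diff_locallyP _ _).1 dH.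
move=> /nbhs_norm0P[r /= r0 Hr]; exists r => // h hr; have := Hr h hr.
rewrite /= opprD addrA; congr (`|_ - _| <= _).
rewrite {1}[h]row_sum_delta linear_sum; apply: eq_bigr => i _.
by rewrite linearZ/= deriveE.
Qed.

Lemma is_derive_line (V : normedModType R) (H : V -> R) (x v : V) (s : R) :
  derivable H (x + s *: v) v ->
  is_derive s (1 : R) (fun t : R => H (x + t *: v)) ('D_v H (x + s *: v)).
Proof.
have E : (fun h : R => h^-1 *: (((fun t : R => H (x + t *: v)) \o shift s) (h *: 1)
            - H (x + s *: v))) =
         (fun h : R => h^-1 *: ((H \o shift (x + s *: v)) (h *: v) - H (x + s *: v))).
  apply/funext => h /=; congr (_ *: (H _ - _)).
  by rewrite [h *: 1]mulr1 scalerDl addrCA.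
by move=> dH; apply: DeriveDef; rewrite /derivable /derive E.
Qed.

Lemma MVT_line (V : normedModType R) (H : V -> R) (v x : V) (t : R) :
  (forall y, derivable H y v) ->
  exists2 c : R, `|c| <= `|t| & H (x + t *: v) - H x = 'D_v H (x + c *: v) * t.
Proof.
move=> dH; pose f (s : R) := H (x + s *: v).
have df (s : R) : is_derive s (1 : R) f ('D_v H (x + s *: v)) by exact: is_derive_line.
have cf : continuous f.
  move=> s; apply: differentiable_continuous; apply/derivable1_diffP.
  by have [] := df s.
have f0 : f 0 = H x by rewrite /f scale0r addr0.
have [t0|t0] := leP 0 t.
  have [c /itvP cI E] := MVT_segment t0 (fun s _ => df s) (continuous_subspaceT cf).
  by exists c; [rewrite !ger0_norm ?cI|rewrite -f0 E subr0].
have [c /itvP cI E] := MVT_segment (ltW t0) (fun s _ => df s) (continuous_subspaceT cf).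
exists c; first by rewrite !ler0_norm ?cI ?(ltW t0)// lerN2 cI.
by rewrite -f0 -[LHS]opprB E sub0r mulrN opprK.
Qed.

Lemma continuous_row (V : topologicalType) (f : V -> E) :
  (forall i, continuous (fun x => f x 0 i)) -> continuous f.
Proof.
move=> fc x; apply/cvgrPdist_le => e e0; near=> y.
apply: row_norm_le (ltW e0) _ => i; rewrite !mxE.
move: i; near: y; apply: filter_forall => i.
exact: (cvgrPdist_le _ _).1 (fc i x) _ e0.
Unshelve. all: by end_near. Qed.

(* Moving from [x] to [x + h] one coordinate at a time reduces the increment of
   [H] to one-variable mean values. *)
Lemma continuous_partials_differentiable (H : E -> R) :
  (forall i y, derivable H y (e_ i)) -> (forall i, continuous ('D_(e_ i) H)) ->
  forall x, differentiable H x.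
Proof.
move=> dH cD x.
pose G i := 'D_(e_ i) H x.
suff HG : forall e : R, 0 < e -> exists2 r, 0 < r & forall h : E, `|h| < r ->
    `|H (h + x) - H x - \sum_i h 0 i * G i| <= e * `|h|.
  by have [] := differentiable_gradP HG.
move=> e e0.
(* Each of the d coordinates may cost this much; d + 1 avoids a division by 0 when d = 0. *)
have d0 : 0 < e / d.+1%:R by rewrite divr_gt0 // ltr0n.
have [r r0 Hr] : exists2 r, 0 < r & forall (z : E) (i : 'I_d), `|z| < r ->
    `|'D_(e_ i) H (z + x) - G i| <= e / d.+1%:R.
  have : \forall z \near (0 : E), forall i : 'I_d, `|'D_(e_ i) H (z + x) - G i| <= e / d.+1%:R.
    near=> z; near: z; apply: filter_forall => i.
    have /cvgrPdistC_le/(_ _ d0) := cD i x.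
    move=> /nbhs_normP[r /= r0 Hr]; have : \forall z \near (0 : E), `|z| < r by exact: nbhs0_lt.
    apply: filterS => z zr.
    by apply: Hr; rewrite /= opprD addrCA subrr addr0 normrN.
  by move=> /nbhs_norm0P[r /= r0 Hr]; exists r => // z i /Hr; exact.
exists r => // h hr.
pose p (k : nat) : E := \row_i (if (i < k)%N then h 0 i else 0).
have pS (k : 'I_d) : p k.+1 = p k + h 0 k *: e_ k.
  apply/rowP => i; rewrite !mxE /= ltnS; have [->|ik] := eqVneq i k.
    by rewrite leqnn ltnn mulr1 add0r.
  by rewrite mulr0 addr0 leq_eqVlt (negbTE (ik : (i != k :> nat))).
have pd : p d = h by apply/rowP => i; rewrite mxE ltn_ord.
have p0 : p 0%N = 0 by apply/rowP => i; rewrite !mxE.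
have step (k : 'I_d) : `|H (p k.+1 + x) - H (p k + x) - h 0 k * G k| <= e / d.+1%:R * `|h|.
  have [c ct] := MVT_line (p k + x) (h 0 k) (dH k).
  rewrite pS addrAC => ->; rewrite [_ * h 0 k]mulrC -mulrBr normrM mulrC.
  apply: ler_pM => //; last exact: le_coord_norm.
  rewrite addrAC; apply: Hr; apply: le_lt_trans hr.
  apply: row_norm_le => // i; rewrite !mxE eqxx/=.
  have [->|ik] := eqVneq i k; first by rewrite ltnn mulr1 add0r (le_trans ct)// le_coord_norm.
  rewrite mulr0 addr0; case: ifP => _; first exact: le_coord_norm.
  by rewrite normr0.
have -> : H (h + x) - H x - \sum_i h 0 i * G i =
          \sum_(k < d) (H (p k.+1 + x) - H (p k + x) - h 0 k * G k).
  rewrite sumrB; congr (_ - _).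
  rewrite -(big_mkord predT (fun k => H (p k.+1 + x) - H (p k + x))).
  by rewrite telescope_sumr// pd p0 add0r.
apply: le_trans (ler_norm_sum _ _ _) _.
apply: le_trans (ler_sum _ (fun k _ => step k)) _.
rewrite sumr_const card_ord -[_ *+ d]mulr_natl mulrA ler_wpM2r// mulrCA.
have q : d%:R / d.+1%:R <= 1 :> R by rewrite ler_pdivrMr ?ltr0n// mul1r ler_nat.
by rewrite ler_piMr// ltW.
Unshelve. all: by end_near. Qed.

(* A family of C^k functions; [b] asks in addition for bounds, uniform in the
   index, on the functions and on their partial derivatives up to order [k]. *)
Fixpoint reg (b : bool) (T : Type) (k : nat) (H : T -> E -> R) : Prop :=
  [/\ forall t, continuous (H t),
      b -> exists M : R, forall t x, `|H t x| <= M &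
      if k is k'.+1 then (forall t x, differentiable (H t) x) /\
         forall i, reg b k' (fun t => 'D_(e_ i) (H t))
      else True].

Section Reg.
Variables (b : bool) (T : Type).
Implicit Types (H K : T -> E -> R).

Lemma reg_continuous k H : reg b k H -> forall t, continuous (H t).
Proof. by case: k => [|k] []. Qed.

Lemma reg_bounded k H : reg true k H -> exists M : R, forall t x, `|H t x| <= M.
Proof. by case: k => [|k] [_ /(_ isT)]. Qed.

Lemma reg_differentiable k H : reg b k.+1 H -> forall t x, differentiable (H t) x.
Proof. by case=> _ _ []. Qed.

Lemma reg_partial k H : reg b k.+1 H -> forall i, reg b k (fun t => 'D_(e_ i) (H t)).
Proof. by case=> _ _ []. Qed.

Lemma regS k H : reg b k.+1 H -> reg b k H.
Proof.
elim: k H => [|k IH] H [cH bH [dH DH]]; first by split.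
by split=> //; split=> // i; exact: IH.
Qed.

Lemma reg_leq j k H : (j <= k)%N -> reg b k H -> reg b j H.
Proof.
move=> /subnK <-; elim: (k - j)%N => // l IH; rewrite addSn => /regS; exact: IH.
Qed.

Lemma reg_cst k (c : T -> R) : (b -> exists M : R, forall t, `|c t| <= M) ->
  reg b k (fun t _ => c t).
Proof.
elim: k c => [|k IH] c bc;
  (split; [by move=> t; exact: cst_continuous|by move=> /bc[M cM]; exists M|]) => //.
split=> [t x|i]; first exact: differentiable_cst.
have -> : (fun t => 'D_(e_ i) (fun=> c t)) = (fun (t : T) (_ : E) => 0 : R).
  by apply/funext => t; apply/funext => x; rewrite (derive_cst (c t)).
by apply: (IH (fun=> 0)) => _; exists 0 => t; rewrite normr0.
Qed.

Lemma regD k H K : reg b k H -> reg b k K -> reg b k (fun t x => H t x + K t x).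
Proof.
elim: k H K => [|k IH] H K [cH bH DH] [cK bK DK];
  (split; [by move=> t x; apply: continuousD; [exact: cH|exact: cK]
          |by move=> bb; have [M HM] := bH bb; have [N KN] := bK bb;
            exists (M + N) => t x; rewrite (le_trans (ler_normD _ _))// lerD|]) => //.
case: DH DK => dH DH [dK DK]; split=> [t x|i].
  by apply: differentiableD; [exact: dH|exact: dK].
have -> : (fun t => 'D_(e_ i) (fun x => H t x + K t x)) =
          (fun t x => 'D_(e_ i) (H t) x + 'D_(e_ i) (K t) x).
  apply/funext => t; apply/funext => x.
  by rewrite -deriveD//; exact: diff_derivable.
by apply: IH; [exact: DH|exact: DK].
Qed.

Lemma regM k H K : reg b k H -> reg b k K -> reg b k (fun t x => H t x * K t x).
Proof.
elim: k H K => [|k IH] H K rH rK; case: (rH) (rK) => [cH bH DH] [cK bK DK];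
  (split; [by move=> t x; apply: continuousM; [exact: cH|exact: cK]
          |by move=> bb; have [M HM] := bH bb; have [N KN] := bK bb;
            exists (M * N) => t x; rewrite normrM ler_pM|]) => //.
case: DH DK => dH DH [dK DK]; split=> [t x|i].
  by apply: differentiableM; [exact: dH|exact: dK].
have -> : (fun t => 'D_(e_ i) (fun x => H t x * K t x)) =
          (fun t x => H t x * 'D_(e_ i) (K t) x + K t x * 'D_(e_ i) (H t) x).
  apply/funext => t; apply/funext => x.
  by rewrite -[RHS]deriveM//; exact: diff_derivable.
by apply: regD; [apply: IH (regS rH) (DK i)|apply: IH (regS rK) (DH i)].
Qed.

Lemma regZ k (c : R) H : reg b k H -> reg b k (fun t x => c * H t x).
Proof.
move=> rH; apply: (regM (H := fun _ _ => c)) => //.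
by apply: (reg_cst k (c := fun=> c)) => _; exists `|c|.
Qed.

Lemma regN k H : reg b k H -> reg b k (fun t x => - H t x).
Proof. by move=> /(regZ (-1)); under eq_fun do under eq_fun do rewrite mulN1r. Qed.

Lemma reg_sum k (I : Type) (r : seq I) (H : I -> T -> E -> R) :
  (forall i, reg b k (H i)) -> reg b k (fun t x => \sum_(i <- r) H i t x).
Proof.
move=> rH; elim: r => [|i r IH].
  under eq_fun do under eq_fun do rewrite big_nil.
  by apply: (reg_cst k (c := fun=> 0)) => _; exists 0 => _; rewrite normr0.
by under eq_fun do under eq_fun do rewrite big_cons; exact: regD.
Qed.

Lemma reg_prod k (I : Type) (r : seq I) (H : I -> T -> E -> R) :
  (forall i, reg b k (H i)) -> reg b k (fun t x => \prod_(i <- r) H i t x).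
Proof.
move=> rH; elim: r => [|i r IH].
  under eq_fun do under eq_fun do rewrite big_nil.
  by apply: (reg_cst k (c := fun=> 1)) => _; exists 1 => _; rewrite normr1.
by under eq_fun do under eq_fun do rewrite big_cons; exact: regM.
Qed.

Lemma regV k H (c : R) : 0 < c -> (forall t x, c <= `|H t x|) ->
  reg b k H -> reg b k (fun t x => (H t x)^-1).
Proof.
move=> c0 cH; have H0 t x : H t x != 0 by rewrite -normr_gt0 (lt_le_trans c0).
elim: k => [|k IH] rH; case: (rH) => [ctH bH DH];
  (split; [by move=> t x; apply: continuousV => //; exact: ctH
          |by move=> _; exists c^-1 => t x; rewrite normfV lef_pV2 ?posrE ?normr_gt0|]) => //.
case: DH => dH DH; split=> [t x|i]; first exact: differentiableV.
have -> : (fun t => 'D_(e_ i) (fun x => (H t x)^-1)) =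
          (fun t x => - ((H t x)^-1 * (H t x)^-1 * 'D_(e_ i) (H t) x)).
  apply/funext => t; apply/funext => x.
  by rewrite deriveV//; [rewrite scaleNr -exprVn expr2|exact: diff_derivable].
apply: regN; apply: regM (reg_partial rH i).
by apply: regM; apply: IH; exact: regS.
Qed.

Lemma reg_fam (T' : Type) (s : T -> T') k (H : T' -> E -> R) :
  reg b k H -> reg b k (H \o s).
Proof.
elim: k H => [|k IH] H [cH bH DH];
  (split; [by move=> t; exact: cH|by move=> /bH[M HM]; exists M => t; exact: HM|]) => //.
by case: DH => dH DH; split=> [t|i]; [exact: dH|exact: (IH _ (DH i))].
Qed.

End Reg.

Lemma reg_coord (T : Type) k i : reg false k (fun (_ : T) (x : E) => x 0 i).
Proof.
case: k => [|k]; (split; [by move=> _; exact: coord_continuous|by []|]) => //.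
split=> [_ x|j]; first exact: differentiable_coord.
have -> : (fun _ : T => 'D_(e_ j) (fun x : E => x 0 i)) = (fun _ _ => (e_ j) 0 i).
  apply/funext => _; apply/funext => x.
  have /= -> := (esym (congr1 (fun M : E => M 0 i) (derive_id x (e_ j)))).
  by rewrite derive_mx ?mxE//; exact: derivable_id.
exact: (reg_cst k (c := fun=> (e_ j) 0 i)).
Qed.

Lemma differentiable_row (V : normedModType R) (f : V -> E) x :
  (forall i, differentiable (fun y => f y 0 i) x) -> differentiable f x.
Proof.
move=> df; have -> : f = \sum_(i < d) (fun y => f y 0 i *: e_ i).
  by apply/funext => y; rewrite fct_sumE [LHS]row_sum_delta.
by apply: differentiable_sum => i; apply: differentiableZl; exact: df.
Qed.

Lemma derive_row_comp (H : E -> R) (f : E -> E) (v x : E) :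
  differentiable H (f x) -> (forall i, differentiable (fun y => f y 0 i) x) ->
  'D_v (H \o f) x = \sum_i 'D_(e_ i) H (f x) * 'D_v (fun y => f y 0 i) x.
Proof.
move=> dH dfi; have df := differentiable_row dfi.
rewrite deriveE; last exact: differentiable_comp.
rewrite diff_comp//= -(deriveE v df) [X in 'd H _ X]row_sum_delta linear_sum.
apply: eq_bigr => i _; rewrite linearZ/= deriveE // mulrC; congr (_ * _).
  by rewrite -(deriveE v df) derive_mx ?mxE//; exact: diff_derivable.
by rewrite deriveE.
Qed.

Lemma reg_comp (T : Type) k (H : T -> E -> R) (f : T -> E -> E) :
  reg false k H -> (forall i, reg false k (fun t x => f t x 0 i)) ->
  reg false k (fun t => H t \o f t).
Proof.
elim: k H => [|k IH] H rH rf;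
  (have cf t : continuous (f t) by
     apply: continuous_row => i; have /(_ t) := reg_continuous (rf i)).
  by split=> // t x; apply: continuous_comp; [exact: cf|exact: (reg_continuous rH)].
have df t x : differentiable (f t) x.
  by apply: differentiable_row => i; case: (rf i) => _ _ [].
case: (rH) => cH _ [dH DH]; split=> //.
  by move=> t x; apply: continuous_comp; [exact: cf|exact: cH].
split=> [t x|i]; first exact: differentiable_comp.
have -> : (fun t => 'D_(e_ i) (H t \o f t)) =
   (fun t x => \sum_l ('D_(e_ l) (H t) \o f t) x * 'D_(e_ i) (fun y => f t y 0 l) x).
  apply/funext => t; apply/funext => x; rewrite derive_row_comp// => j.
  by case: (rf j) => _ _ [].
apply: reg_sum => l; apply: regM; last exact: (reg_partial (rf l)).
by apply: (IH (fun t => 'D_(e_ l) (H t))) => [|j]; [exact: (reg_partial rH)|exact: regS].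
Qed.

Lemma bounded_compact_support (H : E -> R) (A : R) :
  continuous H -> (forall x, A < `|x| -> H x = 0) -> exists M : R, forall x, `|H x| <= M.
Proof.
move=> cH H0.
have cB : compact [set x : E | `|x| <= `|A|].
  apply: bounded_closed_compact.
    by exists `|A|; split => // M /ltW AM x /= /le_trans; exact.
  apply: (preimage_closed (f := fun x : E => `|x|)) (@closed_le R `|A|) => x _.
  exact: norm_continuous.
have B0 : [set x : E | `|x| <= `|A|] !=set0 by exists 0; rewrite /= normr0.
have cN : {within [set x : E | `|x| <= `|A|], continuous (fun x => `|H x|)}.
  apply: continuous_subspaceT => x; apply: continuous_comp; first exact: cH.
  exact: norm_continuous.
have [c _ cmax] := EVT_max_rV B0 cB cN; exists `|H c| => x.
have [xA|xA] := leP `|x| `|A|; first by apply: cmax; rewrite inE.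
by rewrite H0 ?normr0// (le_lt_trans _ xA)// ler_norm.
Qed.

Lemma derive_near0 (H : E -> R) (A : R) (v : E) :
  (forall x, A < `|x| -> H x = 0) -> forall x, A < `|x| -> 'D_v H x = 0.
Proof.
move=> H0 x Ax.
rewrite (near_eq_derive (g := fun=> 0)) ?derive_cst//.
have oA : open [set y : E | A < `|y|].
  apply: (open_comp (f := fun y : E => `|y|)) (@open_gt R A) => y _.
  exact: norm_continuous.
have : nbhs x [set y : E | A < `|y|] by exact: open_nbhs_nbhs.
by apply: filterS => y /H0.
Qed.

(** The partial derivatives vanish outside the same ball, so the extreme value theorem bounds all of
    them. *)
Lemma reg_compact_support k (H : E -> R) (A : R) :
  reg false k (fun _ : unit => H) -> (forall x, A < `|x| -> H x = 0) ->
  reg true k (fun _ : unit => H).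
Proof.
elim: k H => [|k IH] H rH H0; case: (rH) => cH _ _;
  (split=> //; try by move=> _; have [M HM] := bounded_compact_support (cH tt) H0; exists M).
split=> [t x|i]; first exact: (reg_differentiable rH).
apply: IH => [|x]; last exact: derive_near0.
exact: (reg_partial rH).
Qed.

End Euclid.

(** * Half-integer powers, and the link between [reg], [Cm_on] and [Cm_norm] *)

Section Conversions.
Context {R : realType} {d : nat}.
Notation E := 'rV[R]_d.
Notation e_ i := (delta_mx 0 i : E).

Lemma derive_coordE (H : E -> R) (x v : E) : differentiable H x ->
  'D_v H x = \sum_i v 0 i * 'D_(e_ i) H x.
Proof.
move=> dH; rewrite deriveE// {1}[v]row_sum_delta linear_sum.
by apply: eq_bigr => i _; rewrite linearZ/= deriveE.
Qed.

Lemma reg_lipschitz (T : Type) (H : T -> E -> R) : reg true 1 H ->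
  exists2 L : R, 0 <= L & forall t x y, `|H t x - H t y| <= L * `|x - y|.
Proof.
move=> rH.
have /boolp.choice[M HM] : forall i : 'I_d, exists M : R, forall t x,
    `|'D_(e_ i) (H t) x| <= M.
  by move=> i; exact: reg_bounded (reg_partial rH i).
exists (\sum_i `|M i|) => [|t x y]; first exact: sumr_ge0.
have dH z := reg_differentiable rH t z.
have [z zi] := MVT_line y 1 (fun z => diff_derivable (v := x - y) (dH z)).
rewrite scale1r [y + _]addrC subrK mulr1 => ->; rewrite derive_coordE// mulr_suml.
apply: le_trans (ler_norm_sum _ _ _) _; apply: ler_sum => i _.
rewrite normrM mulrC ler_pM//; last exact: le_coord_norm.
by rewrite (le_trans (HM _ _ _))// ler_norm.
Qed.

(* [t_+^(k + 1/2)], since [Num.sqrt] vanishes on negative numbers. *)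
Definition half_pow (k : nat) (t : R) : R := t ^+ k * Num.sqrt t.

Lemma half_pow_le0 k t : t <= 0 -> half_pow k t = 0.
Proof. by move=> t0; rewrite /half_pow ler0_sqrtr// mulr0. Qed.

Lemma half_pow_ge0 k t : 0 <= half_pow k t.
Proof.
have [t0|t0] := leP t 0; first by rewrite half_pow_le0.
by rewrite mulr_ge0 ?sqrtr_ge0// exprn_ge0// ltW.
Qed.

Lemma half_pow_homo k s t : 0 <= s -> s <= t -> half_pow k s <= half_pow k t.
Proof.
move=> s0 st; rewrite ler_pM ?exprn_ge0 ?sqrtr_ge0//; last by rewrite ler_wsqrtr.
by rewrite lerXn2r// nnegrE (le_trans s0).
Qed.

Lemma half_pow_continuous k : continuous (half_pow k).
Proof.
move=> t; apply: (@continuousM _ _ (fun t : R => t ^+ k) Num.sqrt).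
  exact: exprn_continuous.
exact: sqrt_continuous.
Qed.

Lemma is_derive_half_pow k (t : R) :
  is_derive t (1 : R) (half_pow k.+1) ((k%:R + 3 / 2) * half_pow k t).
Proof.
have [t0|t0|->] := ltgtP t 0.
- rewrite half_pow_le0 ?ltW// mulr0.
  have N : \near t, (0 : R) = half_pow k.+1 t.
    have : \forall s \near t, s < 0 by exact: lt_nbhsl.
    by apply: filterS => s s0; rewrite half_pow_le0// ltW.
  exact: near_eq_is_derive N (is_derive_cst _ _ _).
- have dsq := is_derive1_sqrt t0.
  have dX : is_derive t (1 : R) (id ^+ k.+1 : R -> R) (k.+1%:R * t ^+ k).
    apply: (is_derive_eq (is_deriveX k.+1 (is_derive_id t (1 : R)))).
    by rewrite /GRing.scale/= mulr1.
  have -> : half_pow k.+1 = (id ^+ k.+1 : R -> R) * Num.sqrt.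
    by apply/funext => s; rewrite /half_pow exprfctE.
  apply: (is_derive_eq (is_deriveM dX dsq)).
  rewrite /GRing.scale/= /half_pow exprfctE.
  have s0 : Num.sqrt t != 0 by rewrite gt_eqF ?sqrtr_gt0.
  have -> : t ^+ k.+1 = t ^+ k * (Num.sqrt t * Num.sqrt t).
    by rewrite -expr2 sqr_sqrtr ?exprSr// ltW.
  rewrite -[k.+1%:R]natr1; move: (Num.sqrt t) s0 (t ^+ k) (k%:R) => s s0 p r; field.
  by rewrite s0.
- rewrite half_pow_le0// mulr0.
  (* At 0 the difference quotient in [h] is [half_pow k h], which tends to [half_pow k 0], that is
     0. *)
  have cvg0 : (fun h : R => h^-1 *: ((half_pow k.+1 \o shift 0) (h *: 1) - half_pow k.+1 0))
              @ 0^' --> (0 : R).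
    rewrite -[X in _ --> X](half_pow_le0 k (lexx 0)).
    have : half_pow k @ 0^' --> half_pow k 0.
      exact/continuous_withinNx/half_pow_continuous.
    apply: cvg_trans; apply: near_eq_cvg; near=> h.
    have h0 : h != 0 by near: h; exact: nbhs_dnbhs_neq.
    rewrite /= addr0 [h *: 1]mulr1 (half_pow_le0 _ (lexx 0)) subr0 /half_pow.
    by rewrite /GRing.scale/= exprS -mulrA mulKf.
  by apply: DeriveDef; [apply/cvg_ex; exists 0|exact: cvg_lim].
Unshelve. all: by end_near. Qed.

Lemma reg_half_pow (T : Type) k (f : T -> E -> R) :
  reg false k f -> reg false k (fun t x => half_pow k (f t x)).
Proof.
elim: k f => [|k IH] f rf.
  split=> // t x; apply: continuous_comp; first exact: (reg_continuous rf).
  exact: half_pow_continuous.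
have df := reg_differentiable rf.
have dq (s : R) : differentiable (half_pow k.+1) s.
  by apply/derivable1_diffP; have [] := is_derive_half_pow k s.
split=> //.
  move=> t x; apply: continuous_comp; first exact: (reg_continuous rf).
  exact: half_pow_continuous.
split=> [t x|i]; first exact: (differentiable_comp (df t x) (dq _)).
have -> : (fun t => 'D_(e_ i) (fun x => half_pow k.+1 (f t x))) =
   (fun t x => ((k%:R + 3 / 2) * half_pow k (f t x)) * 'D_(e_ i) (f t) x).
  apply/funext => t; apply/funext => x.
  rewrite [LHS]deriveE; last exact: (differentiable_comp (df t x) (dq _)).
  rewrite (diff_comp (df t x) (dq _)) /= -(deriveE _ (df t x)).
  rewrite diff1E//= derive1E mulrC; congr (_ * _).
  by have [_ ->] := is_derive_half_pow k (f t x).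
apply: regM (reg_partial rf i); apply: regZ; apply: IH; exact: regS.
Qed.

Implicit Types F : E -> E.
Notation iter_partial s H := (foldr (fun i (G : E -> R) => 'D_(e_ i) G) H s).

Lemma derivable_rowP (F : E -> E) (x v : E) :
  (forall i, derivable (fun y => F y 0 i) x v) -> derivable F x v.
Proof. by move=> dF; apply/derivable_mxP => i j; rewrite ord1; exact: dF. Qed.

Lemma derive_row (F : E -> E) (x v : E) :
  (forall i, derivable (fun y => F y 0 i) x v) ->
  'D_v F x = \row_i 'D_v (fun y => F y 0 i) x.
Proof.
move=> dF; rewrite derive_mx; last exact: derivable_rowP.
by apply/rowP => j; rewrite !mxE.
Qed.

Lemma reg_iter_partial b (T : Type) m (H : T -> E -> R) (s : seq 'I_d) :
  (size s <= m)%N -> reg b m H -> reg b (m - size s) (fun t => iter_partial s (H t)).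
Proof.
move=> + rH; elim: s => [|i s IH] /= sm; first by rewrite subn0.
move: (IH (ltnW sm)); rewrite -(subnSK sm) => /reg_partial; exact.
Qed.

Lemma row_coord (G : 'I_d -> E -> R) i : (fun x => (\row_j G j x : E) 0 i) = G i.
Proof. by apply/funext => x; rewrite mxE. Qed.

Lemma iter_pderivE m (F : E -> E) (s : seq 'I_d) : (size s <= m)%N ->
  (forall i, reg false m (fun (_ : unit) x => F x 0 i)) ->
  iter_pderiv s F = fun x => \row_i iter_partial s (fun x => F x 0 i) x.
Proof.
move=> + rF; elim: s => [|k s IH] sm; apply/funext => x.
  by apply/rowP => i; rewrite mxE.
rewrite [LHS]/= IH; last exact: ltnW.
rewrite /pderiv derive_row => [|i].
  by apply/rowP => i; rewrite !mxE; congr ('D__ _ _); apply/funext => y; rewrite mxE.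
rewrite row_coord.
have := reg_iter_partial (ltnW sm) (rF i); rewrite -(subnSK sm).
by move=> /reg_differentiable/(_ tt x) /diff_derivable.
Qed.

Lemma reg_Cm_on m (F : E -> E) :
  (forall i, reg false m (fun (_ : unit) x => F x 0 i)) -> Cm_on m setT F.
Proof.
move=> rF s sm x _; rewrite (iter_pderivE sm rF); split=> [|sm' k].
  suff cF : continuous (fun x => \row_i iter_partial s (fun x => F x 0 i) x) by exact: cF.
  apply: continuous_row => i; rewrite row_coord.
  exact: (reg_continuous (reg_iter_partial sm (rF i))).
apply: derivable_rowP => i; rewrite row_coord.
have := reg_iter_partial sm (rF i); rewrite -(subnSK sm').
by move=> /reg_differentiable/(_ tt x) /diff_derivable.
Qed.

(** [Cm_on] speaks of partial derivatives and [reg] of differentiability; continuity of the partial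
    derivatives bridges the gap at each order. *)
Lemma Cm_on_reg m (F : E -> E) (i : 'I_d) :
  Cm_on m setT F -> reg false m (fun (_ : unit) x => F x 0 i).
Proof.
elim: m F => [|m IH] F CF.
  have cF := fun x => (CF [::] isT x I).1.
  split=> // _ x; exact: (continuous_comp (cF x) (@coord_continuous _ _ _ 0 i _)).
have cF := fun x => (CF [::] isT x I).1.
have dF k x : derivable (fun y => F y 0 i) x (e_ k).
  by apply: (derivable_mxP _ _ _).1; exact: ((CF [::] isT x I).2 isT k).
(* [foldr] applies the last letter of a word first, so differentiating the k-th partial derivative
   along a word amounts to appending k on the right. *)
have CD k : Cm_on m setT (pderiv k F).
  move=> s sm x _; have := CF (rcons s k); rewrite size_rcons => /(_ sm x I).
  by rewrite /iter_pderiv foldr_rcons.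
have DE k : (fun x => pderiv k F x 0 i) = 'D_(e_ k) (fun x => F x 0 i).
  apply/funext => x; rewrite /pderiv derive_mx ?mxE//.
  exact: ((CF [::] isT x I).2 isT k).
split=> //.
  move=> _ x; exact: (continuous_comp (cF x) (@coord_continuous _ _ _ 0 i _)).
split=> [_ x|k]; last by rewrite -DE; exact: IH.
apply: continuous_partials_differentiable => k //.
by rewrite -DE; exact: (reg_continuous (IH _ (CD k))).
Qed.

(** Spelling a multi-index as a word turns [mderiv] into [iter_pderiv], and later a monomial into a
    product over a list, so that inductions run on lists. *)
Definition word_of (alpha : 'I_d -> nat) : seq 'I_d :=
  flatten [seq nseq (alpha i) i | i <- enum 'I_d].

Lemma size_word_of alpha : size (word_of alpha) = (\sum_i alpha i)%N.
Proof.
rewrite /word_of size_flatten /shape -map_comp sumnE big_map big_enum/=.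
by apply: eq_bigr => i _; rewrite /= size_nseq.
Qed.

Lemma mderivE alpha F : mderiv alpha F = iter_pderiv (word_of alpha) F.
Proof.
rewrite /mderiv /iter_pderiv /word_of; elim: (enum _) => //= i s ->.
by rewrite foldr_cat; elim: (alpha i) => //= n ->.
Qed.

Lemma euclidean_norm_scale_delta (c : R) (a : 'I_d) :
  euclidean_norm (c *: e_ a) = `|c|.
Proof.
rewrite /euclidean_norm (bigD1 a)//= big1 ?addr0 => [|i ia].
  by rewrite !mxE !eqxx mulr1 sqrtr_sqr.
by rewrite !mxE eqxx (negbTE ia) mulr0 expr0n.
Qed.

Lemma le_euclidean_norm (x : E) : `|x| <= euclidean_norm x.
Proof.
apply: row_norm_le => [|i]; first exact: sqrtr_ge0.
rewrite -sqrtr_sqr ler_wsqrtr// (bigD1 i)//= lerDl.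
by apply: sumr_ge0 => j _; exact: sqr_ge0.
Qed.

Lemma reg_delta b (T : Type) m (H : T -> E -> R) (a i : 'I_d) :
  reg b m H -> reg b m (fun t x => (H t x *: e_ a) 0 i).
Proof.
move=> /(regZ ((e_ a) 0 i)).
by under [in X in _ -> X]eq_fun do under eq_fun do rewrite mxE mulrC.
Qed.

Lemma iter_partialZ m (c : R) (H : E -> R) s : (size s <= m)%N ->
  reg false m (fun _ : unit => H) ->
  iter_partial s (fun x => c * H x) = fun x => c * iter_partial s H x.
Proof.
move=> + rH; elim: s => [//|k s IH] sm /=; rewrite IH; last exact: ltnW.
apply/funext => x.
have := reg_iter_partial (ltnW sm) rH; rewrite -(subnSK sm).
by move=> /reg_differentiable/(_ tt x) dx; rewrite [LHS]deriveMl//; exact: diff_derivable.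
Qed.

Lemma reg_weaken (T : Type) m (H : T -> E -> R) : reg true m H -> reg false m H.
Proof.
elim: m H => [|m IH] H rH; case: (rH) => cH bH _; split=> //.
by split=> [|i]; [exact: (reg_differentiable rH)|exact: IH (reg_partial rH i)].
Qed.

(** Linear in [c] and uniform in [t]: when [t] is the parameter of an inverse shear, the cost of a
    shear tends to 0 with its parameter. *)
Lemma Cm_norm_delta_le (T : Type) m (H : T -> E -> R) (a : 'I_d) : reg true m H ->
  exists2 M : R, 0 <= M & forall t (c : R),
    (Cm_norm m (fun x => (c * H t x) *: e_ a) <= (`|c| * M)%:E)%E.
Proof.
move=> rH.
have rHf t : reg false m (fun _ : unit => H t).
  by apply: reg_weaken; exact: (reg_fam (fun _ : unit => t) rH).
have /boolp.choice[M HM] : forall alpha : {ffun 'I_d -> 'I_m.+1}, exists M : R,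
    (\sum_i alpha i <= m)%N -> forall t x,
    `|iter_partial (word_of (fun i => alpha i : nat)) (H t) x| <= M.
  move=> alpha; have [sm|] := boolP (\sum_i alpha i <= m)%N; last by exists 0.
  rewrite -(size_word_of (fun i => alpha i : nat)) in sm.
  by have [M HM] := reg_bounded (reg_iter_partial sm rH); exists M => _.
exists (\sum_(alpha : {ffun 'I_d -> 'I_m.+1} | (\sum_i alpha i <= m)%N) `|M alpha|) => [|t c].
  exact: sumr_ge0.
rewrite mulr_sumr -sumEFin; apply: lee_sum => alpha sm.
apply: ge_ereal_sup => _ [x _ <-]; rewrite lee_fin mderivE.
have sm' : (size (word_of (fun i => alpha i : nat)) <= m)%N by rewrite size_word_of.
have rc : reg false m (fun (_ : unit) x => c * H t x) by exact: regZ.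
rewrite (iter_pderivE sm') => [|i]; last exact: reg_delta rc.
have -> : \row_i iter_partial (word_of (fun i => alpha i : nat))
            (fun y => ((c * H t y) *: e_ a) 0 i) x =
  (c * iter_partial (word_of (fun i => alpha i : nat)) (H t) x) *: e_ a.
  apply/rowP => i; rewrite !mxE.
  have -> : (fun y => ((c * H t y) *: e_ a) 0 i) = (fun y => (c * (e_ a) 0 i) * H t y).
    by apply/funext => y; rewrite !mxE mulrAC.
  by rewrite (iter_partialZ _ sm' (rHf t)) mxE mulrAC.
rewrite euclidean_norm_scale_delta normrM ler_wpM2l//.
by rewrite (le_trans (HM _ sm _ _))// ler_norm.
Qed.

End Conversions.

(** * Shears along a coordinate axis and the regularity of their inverses *)

Section Shear.
Context {R : realType} {d : nat}.
Notation E := 'rV[R]_d.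
Notation e_ i := (delta_mx 0 i : E).

Variables (psi : E -> R) (a : 'I_d) (L M e0 : R).
Hypothesis psiL : forall x y, `|psi x - psi y| <= L * `|x - y|.
Hypothesis psi_bounded : exists B : R, forall x, `|psi x| <= B.
Hypothesis dpsi : forall x, differentiable psi x.
Hypothesis psiM : forall x, `|'D_(e_ a) psi x| <= M.
Hypotheses (e0_ge0 : 0 <= e0) (e0L : e0 * L <= 1 / 2) (e0M : e0 * M <= 1 / 2).

Lemma sum_deltaM (F : 'I_d -> R) i : \sum_j (e_ i) 0 j * F j = F i.
Proof.
rewrite (bigD1 i)//= big1 => [|j ji]; first by rewrite mxE !eqxx mul1r addr0.
by rewrite mxE eqxx (negbTE ji) mul0r.
Qed.

(** A type of parameters makes the inverse shears one family, with bounds uniform in the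
    parameter. *)
Definition small : Type := {e : R | `|e| <= e0}.
Implicit Types (t : small) (x y : E).

Definition shear t (x : E) : E := x + (sval t * psi x) *: e_ a.

Lemma sval_small t : `|sval t| <= e0. Proof. by case: t. Qed.

(** The identity plus a 1/2-Lipschitz map shrinks distances by a factor 2 at most. *)
Lemma shear_expand t x y : `|x - y| <= 2 * `|shear t x - shear t y|.
Proof.
have -> : x - y = (shear t x - shear t y) - (sval t * (psi x - psi y)) *: e_ a.
  by rewrite /shear mulrBr scalerBl; apply/rowP => i; rewrite !mxE; ring.
have : `|(sval t * (psi x - psi y)) *: e_ a| <= 1 / 2 * `|x - y|.
  rewrite normrZ norm_delta mulr1 normrM.
  apply: le_trans (ler_pM _ _ (sval_small t) (psiL x y)) _ => //.
  by rewrite mulrA ler_wpM2r.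
have := ler_normB (shear t x - shear t y) ((sval t * (psi x - psi y)) *: e_ a).
have -> : (shear t x - shear t y) - (sval t * (psi x - psi y)) *: e_ a = x - y.
  by rewrite /shear mulrBr scalerBl; apply/rowP => i; rewrite !mxE; ring.
by move=> h1 h2; lra.
Qed.

Lemma shear_inj t : injective (shear t).
Proof.
move=> x y xy; have := shear_expand t x y.
by rewrite xy subrr normr0 mulr0 normr_le0 subr_eq0 => /eqP.
Qed.

Lemma psi_continuous : continuous psi.
Proof. by move=> x; exact: differentiable_continuous. Qed.

(** The shear preserves the line through [y] parallel to [e_ a] and moves its points by a bounded
    amount, so the intermediate value theorem applies on that line. *)
Lemma shear_surj t y : exists x, shear t x = y.
Proof.
have [B HB] := psi_bounded.
pose phi (s : R) := s + sval t * psi (y + s *: e_ a).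
have cphi : continuous phi.
  have cl : continuous (fun s : R => psi (y + s *: e_ a)).
    move=> s; apply: (@continuous_comp _ _ _ (fun s : R => y + s *: e_ a) psi).
      2: exact: psi_continuous.
    apply: (@continuousD _ _ _ (fun=> y) (fun s : R => s *: e_ a)); first exact: cst_continuous.
    exact: scalel_continuous.
  move=> s; apply: cvgD; first exact: cvg_id.
  by apply: cvgM; [exact: cvg_cst|exact: cl].
pose b := e0 * `|B|.
have b0 : 0 <= b by rewrite mulr_ge0.
have bound s : `|sval t * psi (y + s *: e_ a)| <= b.
  by rewrite normrM ler_pM ?sval_small// (le_trans (HB _))// ler_norm.
have h1 : phi (- b) <= 0.
  by have := bound (- b); rewrite ler_norml /phi => /andP[_ ?]; lra.
have h2 : 0 <= phi b.
  by have := bound b; rewrite ler_norml /phi => /andP[? _]; lra.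
have h3 : Num.min (phi (- b)) (phi b) <= 0 <= Num.max (phi (- b)) (phi b).
  by rewrite ge_min h1 le_max h2 orbT.
have bb : - b <= b by lra.
have [s _ s0] := IVT bb (continuous_subspaceT cphi) h3.
exists (y + s *: e_ a); rewrite /shear -addrA -scalerDl -/(phi s) s0.
by rewrite scale0r addr0.
Qed.

Definition unshear t y : E := sval (cid (shear_surj t y)).

Lemma unshearK t : cancel (unshear t) (shear t).
Proof. by move=> y; rewrite /unshear; case: cid. Qed.

Lemma shearK t : cancel (shear t) (unshear t).
Proof. by move=> x; apply: (@shear_inj t); rewrite unshearK. Qed.

Lemma unshearE t y : unshear t y = y - (sval t * psi (unshear t y)) *: e_ a.
Proof. by rewrite -[X in _ = X - _](unshearK t y) /shear addrK. Qed.

Lemma unshear_lip t x y : `|unshear t x - unshear t y| <= 2 * `|x - y|.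
Proof. by have := shear_expand t (unshear t x) (unshear t y); rewrite !unshearK. Qed.

(** The Jacobian determinant of the shear, which alters only the coordinate [a]. *)
Definition jac t x : R := 1 + sval t * 'D_(e_ a) psi x.

Lemma jac_ge t x : 1 / 2 <= jac t x.
Proof.
have : `|sval t * 'D_(e_ a) psi x| <= 1 / 2.
  by rewrite normrM (le_trans _ e0M)// ler_pM// sval_small.
by rewrite ler_norml /jac => /andP[? _]; lra.
Qed.

Lemma jac_ge_norm t x : 1 / 2 <= `|jac t x|.
Proof. exact: le_trans (jac_ge t x) (ler_norm _). Qed.

(** Let D be the increment of [psi] along the inverse. The inverse moves by k = h - t D e_a, so D
    equals grad psi . h - t D d_a psi up to o(h): a scalar linear equation for D with coefficient
    [jac]. *)
Lemma psi_unshear_grad t y :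
  differentiable (fun z => psi (unshear t z)) y /\
  forall i, 'D_(e_ i) (fun z => psi (unshear t z)) y =
            'D_(e_ i) psi (unshear t y) * (jac t (unshear t y))^-1.
Proof.
set x := unshear t y; apply: differentiable_gradP => e e_gt0.
(* One factor 2 is for [|k| <= 2 * |h|], the other for [jac >= 1 / 2]. *)
have e4 : 0 < e / 4 by lra.
have [r r0 Hr] := differentiable_grad (dpsi x) e4.
exists (r / 2) => [|h hr]; first by lra.
pose k := unshear t (h + y) - x.
have kh : `|k| <= 2 * `|h| by have := unshear_lip t (h + y) y; rewrite addrK.
have kr : `|k| < r by lra.
have ku : unshear t (h + y) = k + x by rewrite subrK.
have uE : k + x = (h + y) - (sval t * psi (k + x)) *: e_ a by rewrite -ku; exact: unshearE.
have xE : x = y - (sval t * psi x) *: e_ a by exact: unshearE.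
rewrite ku; set D := psi (k + x) - psi x.
have kE : k = h - (sval t * D) *: e_ a.
  apply/rowP => i; have := congr1 (fun v : E => v 0 i) uE.
  by have := congr1 (fun v : E => v 0 i) xE; rewrite /D !mxE; lra.
have := Hr k kr; rewrite -/D.
have -> : \sum_i k 0 i * 'D_(e_ i) psi x =
    \sum_i h 0 i * 'D_(e_ i) psi x - sval t * D * 'D_(e_ a) psi x.
  transitivity (\sum_i (h 0 i * 'D_(e_ i) psi x - (sval t * D) * ((e_ a) 0 i * 'D_(e_ i) psi x))).
    by apply: eq_bigr => i _; rewrite {1}kE !mxE; ring.
  by rewrite sumrB -mulr_sumr sum_deltaM.
move=> HD; have jp : 0 < jac t x by have := jac_ge t x; lra.
have -> : D - \sum_i h 0 i * ('D_(e_ i) psi x * (jac t x)^-1) =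
   (D - (\sum_i h 0 i * 'D_(e_ i) psi x - sval t * D * 'D_(e_ a) psi x)) * (jac t x)^-1.
  under eq_bigr do rewrite mulrA.
  rewrite -mulr_suml; set S := \sum_i _.
  rewrite {2}/jac; apply/eqP; rewrite eq_sym -subr_eq0; apply/eqP.
  by rewrite -/(jac t x); rewrite /jac; field; rewrite -/(jac t x) gt_eqF.
rewrite normrM normfV (gtr0_norm jp) ler_pdivrMr//.
apply: le_trans HD _; have := jac_ge t x; have h0 : 0 <= `|h| by [].
move=> jj; apply: (@le_trans _ _ (e * `|h| * (1 / 2))); last first.
  by apply: ler_wpM2l => //; apply: mulr_ge0 => //; exact: ltW.
have : e / 4 * `|k| <= e / 4 * (2 * `|h|) by apply: ler_wpM2l => //; exact: ltW.
by move=> q; lra.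
Qed.

Section Regularity.
Variable m : nat.
Hypothesis rpsi : reg true m (fun _ : unit => psi).

Lemma unshear_coord t y l :
  unshear t y 0 l = y 0 l - sval t * (e_ a) 0 l * psi (unshear t y).
Proof. by rewrite {1}unshearE !mxE; ring. Qed.

Lemma unshear_coord_grad t y l :
  differentiable (fun z => unshear t z 0 l) y /\
  forall i, 'D_(e_ i) (fun z => unshear t z 0 l) y =
     (e_ i) 0 l - sval t * (e_ a) 0 l * ('D_(e_ i) psi (unshear t y) * (jac t (unshear t y))^-1).
Proof.
have [dw Dw] := psi_unshear_grad t y.
have -> : (fun z => unshear t z 0 l) =
  (fun z : E => z 0 l) - (sval t * (e_ a) 0 l) *: (fun z => psi (unshear t z)).
  by apply/funext => z; rewrite unshear_coord.
have dc : differentiable (fun z : E => z 0 l) y by exact: differentiable_coord.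
have dZ : differentiable ((sval t * (e_ a) 0 l) *: (fun z => psi (unshear t z))) y.
  exact: differentiableZ.
split=> [|i]; first exact: differentiableB.
rewrite deriveB; [|exact: diff_derivable..].
rewrite deriveZ; last exact: diff_derivable.
rewrite Dw; congr (_ - _); have := derive_id y (e_ i).
move=> /(congr1 (fun v : E => v 0 l)) <-.
by rewrite derive_mx ?mxE//; exact: derivable_id.
Qed.

(** The induction is over all families [K]: a partial derivative of [K t] composed with the inverse
    is some [N t] composed with the inverse, where [N] involves only first derivatives of [K] and
    [psi]. So a first-order formula for the inverse is enough. *)
Lemma reg_unshear (K : small -> E -> R) j : (j <= m)%N -> reg true j K ->
  reg true j (fun t y => K t (unshear t y)).
Proof.
elim: j K => [|j IH] K jm rK.
  split=> // [t y|_]; last by have [B HB] := reg_bounded rK; exists B => t y; exact: HB.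
  apply: (@continuous_comp _ _ _ (unshear t) (K t)); last exact: (reg_continuous rK).
  have : continuous (unshear t); last exact.
  apply: continuous_row => l {}y; apply: differentiable_continuous.
  exact: (unshear_coord_grad t y l).1.
have dK := reg_differentiable rK.
have du t y : differentiable (unshear t) y.
  by apply: differentiable_row => l; exact: (unshear_coord_grad t y l).1.
have dKu t y : differentiable (fun y => K t (unshear t y)) y.
  exact: (differentiable_comp (du t y) (dK t _)).
split.
- by move=> t y; apply: differentiable_continuous.
- by move=> _; have [B HB] := reg_bounded rK; exists B => t y; exact: HB.
split=> // i.
pose N t x := 'D_(e_ i) (K t) x -
   sval t * (('D_(e_ a) (K t) x * 'D_(e_ i) psi x) * (jac t x)^-1).
have -> : (fun t => 'D_(e_ i) (fun y => K t (unshear t y))) =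
          (fun t y => N t (unshear t y)).
  apply/funext => t; apply/funext => y.
  rewrite [LHS](derive_row_comp (H := K t)) => [||l]; last 2 first.
  - exact: dK.
  - exact: (unshear_coord_grad t y l).1.
  transitivity (\sum_l ((e_ i) 0 l * 'D_(e_ l) (K t) (unshear t y)
      - (e_ a) 0 l * (sval t * ('D_(e_ l) (K t) (unshear t y) * 'D_(e_ i) psi (unshear t y)
            * (jac t (unshear t y))^-1)))).
    by apply: eq_bigr => l _; rewrite (unshear_coord_grad t y l).2; ring.
  by rewrite sumrB !sum_deltaM.
have rT : reg true m (fun _ : small => psi) by exact: (reg_fam (fun _ : small => tt) rpsi).
have rD l : reg true j (fun _ : small => 'D_(e_ l) psi).
  exact: reg_partial (reg_leq jm rT) l.
have reps k : reg true k (fun t (_ : E) => sval t).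
  by apply: reg_cst => _; exists e0 => t; exact: sval_small.
apply: IH; first exact: ltnW.
apply: regD; first exact: reg_partial.
apply: regN; apply: regM => //; apply: regM.
  by apply: regM => //; exact: (reg_partial rK).
apply: (@regV _ _ _ _ _ (jac) (1 / 2)) => //; first exact: jac_ge_norm.
apply: regD; last exact: regM.
by apply: (reg_cst _ (c := fun=> 1)) => _; exists 1 => _; rewrite normr1.
Qed.

End Regularity.

End Shear.

(** * Operations on C^m maps and cheap shears in Diff^m_0 *)

Section Diff0.
Context {R : realType} {d : nat}.
Notation E := 'rV[R]_d.
Notation e_ i := (delta_mx 0 i : E).
Notation iter_partial s H := (foldr (fun i (G : E -> R) => 'D_(e_ i) G) H s).

Lemma Cm_on_comp m (F G : E -> E) :
  Cm_on m setT F -> Cm_on m setT G -> Cm_on m setT (F \o G).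
Proof.
move=> CF CG; apply: reg_Cm_on => i.
apply: (reg_comp (H := fun _ x => F x 0 i) (f := fun _ => G)) => [|j]; exact: Cm_on_reg.
Qed.

Lemma Cm_onD m (F G : E -> E) :
  Cm_on m setT F -> Cm_on m setT G -> Cm_on m setT (fun x => F x + G x).
Proof.
move=> CF CG; apply: reg_Cm_on => i.
have -> : (fun x => (F x + G x) 0 i) = (fun x => F x 0 i + G x 0 i).
  by apply/funext => x; rewrite mxE.
by apply: (regD (H := fun _ x => F x 0 i)); exact: Cm_on_reg.
Qed.

Lemma Cm_on_id m : Cm_on m setT (id : E -> E).
Proof. by apply: reg_Cm_on => i; exact: reg_coord. Qed.

Lemma Cm_on_delta m (H : E -> R) a :
  reg false m (fun _ : unit => H) -> Cm_on m setT (fun x => H x *: e_ a).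
Proof. by move=> rH; apply: reg_Cm_on => i; exact: reg_delta rH. Qed.

Lemma iter_partialD m (H K : E -> R) s : (size s <= m)%N ->
  reg false m (fun _ : unit => H) -> reg false m (fun _ : unit => K) ->
  iter_partial s (fun x => H x + K x) = fun x => iter_partial s H x + iter_partial s K x.
Proof.
move=> + rH rK; elim: s => [//|k s IH] sm /=; rewrite IH; last exact: ltnW.
apply/funext => x.
have := reg_iter_partial (ltnW sm) rH; rewrite -(subnSK sm).
move=> /reg_differentiable/(_ tt x) dx.
have := reg_iter_partial (ltnW sm) rK; rewrite -(subnSK sm).
move=> /reg_differentiable/(_ tt x) dy.
by rewrite [LHS]deriveD//; exact: diff_derivable.
Qed.

Lemma mderivD m (F G : E -> E) (alpha : 'I_d -> nat) :
  (\sum_i alpha i <= m)%N -> Cm_on m setT F -> Cm_on m setT G ->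
  mderiv alpha (fun x => F x + G x) = fun x => mderiv alpha F x + mderiv alpha G x.
Proof.
rewrite -size_word_of => sm CF CG; rewrite !mderivE.
have rF i := Cm_on_reg i CF; have rG i := Cm_on_reg i CG.
rewrite (iter_pderivE sm rF) (iter_pderivE sm rG).
rewrite (iter_pderivE sm); last by move=> i; exact: Cm_on_reg (Cm_onD CF CG).
apply/funext => x; apply/rowP => i; rewrite !mxE.
have -> : (fun x => (F x + G x) 0 i) = (fun x => F x 0 i + G x 0 i).
  by apply/funext => y; rewrite mxE.
by rewrite (iter_partialD sm (rF i) (rG i)).
Qed.

Lemma Cm0D m (F G : E -> E) : Cm0 m F -> Cm0 m G -> Cm0 m (fun x => F x + G x).
Proof.
move=> [CF vF] [CG vG]; split; first exact: Cm_onD.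
move=> alpha sm e e0; rewrite (mderivD sm CF CG).
have [A HA] := vF alpha sm (e / 2) ltac:(lra).
have [B HB] := vG alpha sm (e / 2) ltac:(lra).
exists (Num.max A B) => x; rewrite gt_max => /andP[/HA hA /HB hB].
by apply: le_lt_trans (ler_normD _ _) _; lra.
Qed.

Lemma Cm0_delta m (H : E -> R) (A : R) a : reg false m (fun _ : unit => H) ->
  (forall x, A < `|x| -> H x = 0) -> Cm0 m (fun x => H x *: e_ a).
Proof.
move=> rH H0; split; first exact: Cm_on_delta.
move=> alpha; rewrite -size_word_of => sm e e0; exists A => x Ax; rewrite mderivE.
rewrite (iter_pderivE sm) => [|i]; last exact: reg_delta rH.
rewrite (_ : \row_i _ = 0) ?normr0//; apply/rowP => i; rewrite !mxE.
elim: (word_of alpha) x Ax => [|k s IH] /= x Ax; last exact: derive_near0 Ax.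
by rewrite mxE H0// mul0r.
Qed.

Lemma mderiv0 (F : E -> E) : mderiv (fun=> 0%N) F = F.
Proof. by rewrite mderivE /word_of; elim: (enum _). Qed.

(** The last clause keeps sheared domains in the orbit: [G] is the diffeomorphism that produces the
    domain from [D]. *)
Lemma small_shear m (psi : E -> R) (a : 'I_d) (A : R) : (0 < m)%N ->
  reg false m (fun _ : unit => psi) -> (forall x, A < `|x| -> psi x = 0) ->
  forall eta : R, 0 < eta -> exists2 e : R, 0 < e &
    exists F : diff0 R d m, [/\ forall x, F x = x + (e * psi x) *: e_ a,
      (cm_cost [:: F] < eta%:E)%E &
      forall G : diff0 R d m, exists H : diff0 R d m, forall x, H x = F (G x)].
Proof.
move=> m0 rpsi0 supp eta eta0.
have rpsi := reg_compact_support rpsi0 supp.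
have [L L0 psiL] := reg_lipschitz (reg_leq m0 rpsi).
have [M psiM] := reg_bounded (reg_partial (reg_leq m0 rpsi) a).
have dpsi x := reg_differentiable (reg_leq m0 rpsi) tt x.
have bpsi : exists B : R, forall x, `|psi x| <= B.
  by have [B HB] := reg_bounded rpsi; exists B; exact: (HB tt).
have M0 : 0 <= M by exact: le_trans (normr_ge0 _) (psiM tt 0).
(* A single bound that makes both [e0 * L] and [e0 * M] at most 1/2; the added 1 keeps the
   denominator positive. *)
pose e0 := (2 * (L + M + 1))^-1.
have e0_gt0 : 0 < e0 by rewrite invr_gt0; lra.
have e0E : e0 * (L + M + 1) = 1 / 2 by rewrite /e0; field; lra.
have e0L : e0 * L <= 1 / 2.
  by rewrite -e0E ler_wpM2l// ?ltW//; lra.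
have e0M : e0 * M <= 1 / 2.
  by rewrite -e0E ler_wpM2l// ?ltW//; lra.
pose unsh := unshear a bpsi dpsi (ltW e0_gt0).
have rw := reg_unshear (a := a) (psiL tt) bpsi dpsi (psiM tt) (ltW e0_gt0) e0L e0M rpsi (leqnn m)
  (reg_fam (fun _ : small e0 => tt) rpsi).
have [C1 C10 HC1] := Cm_norm_delta_le a rpsi.
have [C2 C20 HC2] := Cm_norm_delta_le a rw.
(* The cost is at most [e * (C1 + C2)]: [C1] is for the shear, [C2] for all inverses with parameter
   up to [e0]. *)
pose e := Num.min e0 (eta / (C1 + C2 + 1) / 2).
have e_gt0 : 0 < e by rewrite lt_min e0_gt0/= !divr_gt0//; lra.
have ee0 : `|e| <= e0 by rewrite gtr0_norm// ge_min lexx.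
pose t : small e0 := exist _ e ee0.
have ceta : e * (C1 + C2) < eta.
  set k := eta / (C1 + C2 + 1) in e e_gt0 ee0 t *.
  have k0 : 0 < k by apply: divr_gt0 => //; lra.
  have kE : k * (C1 + C2 + 1) = eta by rewrite /k divfK// gt_eqF//; lra.
  have ek : e <= k / 2 by rewrite ge_min lexx orbT.
  have C0 : 0 <= C1 + C2 by exact: addr_ge0.
  have := ler_wpM2r C0 ek; clear -kE k0 eta0 => q; lra.
have unE y : unsh t y = y - (e * psi (unsh t y)) *: e_ a by exact: unshearE.
exists e => //.
have fC : Cm_on m setT (shear psi a t).
  apply: Cm_onD; first exact: Cm_on_id.
  by apply: (Cm_on_delta (H := fun x => e * psi x)); exact: regZ.
have rwf : reg false m (fun _ : unit => fun y => psi (unsh t y)).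
  by apply: reg_weaken; exact: (reg_fam (fun _ : unit => t) rw).
have gC : Cm_on m setT (unsh t).
  have -> : unsh t = fun y => y + (- e * psi (unsh t y)) *: e_ a.
    by apply/funext => y; rewrite {1}unE mulNr scaleNr.
  apply: Cm_onD; first exact: Cm_on_id.
  apply: (Cm_on_delta (H := fun y => - e * psi (unsh t y))).
  exact: (regZ _ (H := fun _ y => psi (unsh t y))).
have f0 : Cm0 m (fun x => shear psi a t x - x).
  have -> : (fun x => shear psi a t x - x) = fun x => (e * psi x) *: e_ a.
    by apply/funext => x; rewrite /shear addrAC subrr add0r.
  apply: (Cm0_delta (H := fun x => e * psi x) (A := A)); first exact: regZ.
  by move=> x /supp ->; rewrite mulr0.
have fK := shearK a (psiL tt) bpsi dpsi (ltW e0_gt0) e0L t.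
have gK := unshearK a bpsi dpsi (ltW e0_gt0) t.
pose F := Diff0 fK gK fC gC f0.
exists F; split=> //.
  rewrite /cm_cost big_seq1.
  have -> : (fun x => F x - x) = fun x => (e * psi x) *: e_ a.
    by apply/funext => x; rewrite /= /shear addrAC subrr add0r.
  have -> : (fun x => diff0_inv F x - x) = fun x => (- e * psi (unsh t x)) *: e_ a.
    by apply/funext => x; rewrite [diff0_inv F x]unE addrAC subrr add0r mulNr scaleNr.
  apply: le_lt_trans (leeD (HC1 tt e) (HC2 t (- e))) _.
  by rewrite -EFinD lte_fin normrN gtr0_norm// -mulrDr.
move=> G.
have [cG vG] := diff0_Cm0 G.
have fgC : Cm_on m setT (F \o G) by apply: Cm_on_comp; [exact: fC|exact: diff0_funC].
have gfC : Cm_on m setT (diff0_inv G \o diff0_inv F).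
  by apply: Cm_on_comp; [exact: diff0_invC|exact: gC].
have fg0 : Cm0 m (fun x => (F \o G) x - x).
  have -> : (fun x => (F \o G) x - x) = fun x => (G x - x) + (e * psi (G x)) *: e_ a.
    by apply/funext => x; rewrite /= /shear addrAC.
  apply: Cm0D; first exact: diff0_Cm0.
  (* Beyond radius [B] the map [G] moves points by less than 1, so a point beyond [A + 1] is sent
     beyond [A], where [psi] vanishes. *)
  have [B HB] := vG (fun=> 0%N) ltac:(by rewrite big1) 1 ltr01.
  apply: (Cm0_delta (H := fun x => e * psi (G x)) (A := Num.max B (A + 1))).
    apply: regZ; apply: (reg_comp (H := fun _ : unit => psi) (f := fun _ => G) rpsi0) => i.
    by apply: Cm_on_reg; exact: diff0_funC.
  move=> x; rewrite gt_max => /andP[/HB]; rewrite mderiv0 => h1 h2.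
  rewrite supp ?mulr0//; have := ler_normB (G x) (G x - x).
  by rewrite subKr; lra.
have fgK : cancel (F \o G) (diff0_inv G \o diff0_inv F).
  by move=> x; rewrite /= fK diff0_funK.
have gfK : cancel (diff0_inv G \o diff0_inv F) (F \o G).
  by move=> x; rewrite /= diff0_invK gK.
by exists (Diff0 fgK gfK fgC gfC fg0).
Qed.

End Diff0.

#[local] Existing Instance totally_filter.

(** * Unconditional convergence along finite sets of indices *)

Section Nets.
Context {R : realType} {I : choiceType}.
Local Open Scope fset_scope.
Implicit Types (v w : I -> R) (J : {fset I}).

Lemma partial_sumE (V : zmodType) (v : I -> V) J :
  partial_sum v J = (\sum_(i <- J) v i)%R.
Proof. by rewrite /partial_sum big_seq_fsetE. Qed.

Lemma cvg_totally_ball v (l e : R) : partial_sum v @ totally --> l -> (0 < e)%R ->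
  exists J, forall K, J `<=` K -> (`|\sum_(i <- K) v i - l| < e)%R.
Proof.
move=> /cvgrPdistC_lt h e0; have [J _ HJ] := h e e0; exists J => K /HJ.
by rewrite /= partial_sumE.
Qed.

Lemma totally_all (X : eqType) (s : seq X) (P : X -> set {fset I}) :
  (forall x, x \in s -> (@totally I) (P x)) ->
  (@totally I) [set J | forall x, x \in s -> P x J].
Proof.
elim: s => [|x s IH] Ps; first by exists fset0 => // J _ x.
have TF : Filter (@totally I) := totally_filter.
have IHs := IH (fun y ys => Ps y (mem_behead (s := x :: s) ys)).
have := @filterI _ _ TF _ _ (Ps x (mem_head _ _)) IHs.
by apply: filterS => J [h1 h2] y; rewrite inE => /predU1P[->|/h2].
Qed.

Lemma sum_fsetU_disj v (A B : {fset I}) : [disjoint A & B] ->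
  (\sum_(i <- A `|` B) v i = \sum_(i <- A) v i + \sum_(i <- B) v i)%R.
Proof.
move=> dAB; rewrite (big_fsetID _ (mem A))/=; congr (_ + _)%R; apply: eq_fbigl => i.
  by rewrite !inE/=; case: (i \in A); rewrite ?andbF.
rewrite !inE/=; have := fdisjointP dAB i.
by case: (i \in A) => [/(_ isT)/negbTE ->|_] /=; rewrite ?andbF ?andbT.
Qed.

(* Unconditional convergence bounds the sums of absolute values: add to a large
   finite set the indices of the terms of one sign. *)
Lemma cvg_totally_abs_bounded v (l : R) : partial_sum v @ totally --> l ->
  exists2 B : R, (0 <= B)%R & forall J, (\sum_(i <- J) `|v i| <= B)%R.
Proof.
move=> /cvg_totally_ball/(_ ltr01)[J0 H0].
(* The sums over [J0] and over its union with [K] are both within 1 of the limit. *)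
have disj (K : {fset I}) : [disjoint J0 & K] -> (`|\sum_(i <- K) v i| < 2)%R.
  move=> d0; have h1 := H0 _ (fsubset_refl J0).
  have h2 := H0 _ (fsubsetUl J0 K); rewrite sum_fsetU_disj// in h2.
  move: h1 h2; rewrite !ltr_norml.
  set a := (\sum_(i <- J0) _)%R; set b := (\sum_(i <- K) _)%R.
  by move=> /andP[? ?] /andP[? ?]; apply/andP; split; lra.
(* Outside [J0], the terms of each sign contribute at most 2. *)
exists (4 + \sum_(i <- J0) `|v i|)%R => [|J]; first by rewrite addr_ge0// sumr_ge0.
have J0J : [disjoint J0 & J `\` J0] by apply/fdisjointP => i iJ; rewrite !inE iJ.
have -> : J = (J `&` J0) `|` (J `\` J0) by rewrite fsetID.
rewrite sum_fsetU_disj; last by apply: fdisjointWl J0J; exact: fsubsetIr.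
rewrite addrC lerD//; last first.
  rewrite [leRHS](big_fsetID _ (mem J))/= -[leLHS]addr0 lerD//; last by rewrite sumr_ge0.
  rewrite le_eqVlt; apply/orP; left; apply/eqP; apply: eq_fbigl => i.
  by rewrite !inE andbC.
rewrite (big_fsetID _ [pred i | 0 <= v i]%R)/=.
set K2 := [fset x in J `\` J0 | _]; set K1 := [fset x in J `\` J0 | _].
have s1 : K1 `<=` J `\` J0 by exact: fset_sub.
have s2 : K2 `<=` J `\` J0 by exact: fset_sub.
have h1 := disj K1 (fdisjointWr s1 J0J).
have h2 := disj K2 (fdisjointWr s2 J0J).
have -> : (\sum_(i <- K1) `|v i| = `|\sum_(i <- K1) v i|)%R.
  have e1 : (\sum_(i <- K1) `|v i| = \sum_(i <- K1) v i)%R.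
    by apply: eq_big_seq => i; rewrite !inE/= => /andP[_ vi]; rewrite ger0_norm.
  by rewrite -e1 ger0_norm// sumr_ge0.
have -> : (\sum_(i <- K2) `|v i| = `|\sum_(i <- K2) v i|)%R.
  have e1 : (\sum_(i <- K2) `|v i| = - \sum_(i <- K2) v i)%R.
    rewrite -sumrN; apply: eq_big_seq => i; rewrite !inE/= => /andP[_ vi].
    by rewrite ltr0_norm// ltNge.
  by rewrite -normrN -e1 ger0_norm// sumr_ge0.
by lra.
Qed.

Lemma cvg_totally_le v (l x e : R) J0 : partial_sum v @ totally --> l ->
  (forall J, J0 `<=` J -> `|\sum_(i <- J) v i - x| <= e)%R -> (`|l - x| <= e)%R.
Proof.
move=> vl HJ; apply/ler_addgt0Pr => d d0.
have [J1 H1] := cvg_totally_ball vl d0.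
have := H1 _ (fsubsetUr J0 J1); have := HJ _ (fsubsetUl J0 J1).
set s := (\sum_(i <- _) _)%R; move=> h1 h2.
have -> : (l - x = (s - x) - (s - l))%R by ring.
by apply: le_trans (ler_normB _ _) _; lra.
Qed.

End Nets.

(** * Majorants and extrapolation for polynomials *)

Section Majorants.
Context {R : realType}.
Implicit Types p q P Q : {poly R}.

(** Cauchy's majorants, for polynomials: a power series is handled through its finite partial
    sums. *)
Definition majorant p P := forall i, `|p`_i| <= P`_i.

Lemma majorant_refl_abs p : majorant p (map_poly Num.norm p).
Proof. by move=> i; rewrite coef_map_id0 ?normr0. Qed.

Lemma majorantD p q P Q : majorant p P -> majorant q Q -> majorant (p + q) (P + Q).
Proof. by move=> pP qQ i; rewrite !coefD (le_trans (ler_normD _ _))// lerD. Qed.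

Lemma majorantM p q P Q : majorant p P -> majorant q Q -> majorant (p * q) (P * Q).
Proof.
move=> pP qQ i; rewrite !coefM (le_trans (ler_norm_sum _ _ _))//.
by apply: ler_sum => j _; rewrite normrM ler_pM.
Qed.

Lemma majorant1 : majorant 1 1.
Proof. by move=> i; rewrite coefC; case: eqP; rewrite ?normr1 ?normr0. Qed.

Lemma majorantZ (c : R) p P : majorant p P -> majorant (c *: p) (`|c| *: P).
Proof. by move=> pP i; rewrite !coefZ normrM ler_wpM2l. Qed.

Lemma majorant_prod_seq (T : Type) (s : seq T) (p : T -> {poly R}) Q :
  (forall i, majorant (p i) Q) -> majorant (\prod_(i <- s) p i) (Q ^+ size s).
Proof.
move=> pQ; elim: s => [|i s IH]; first by rewrite big_nil; exact: majorant1.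
by rewrite big_cons exprS; exact: majorantM.
Qed.

Lemma majorant_sum (T : Type) (s : seq T) (p P : T -> {poly R}) :
  (forall i, majorant (p i) (P i)) ->
  majorant (\sum_(i <- s) p i) (\sum_(i <- s) P i).
Proof.
move=> pP; elim: s => [|i s IH].
  by rewrite !big_nil => i; rewrite coef0 normr0.
by rewrite !big_cons; exact: majorantD.
Qed.

Lemma majorant_ge0 p P i : majorant p P -> 0 <= P`_i.
Proof. by move=> /(_ i); exact: le_trans. Qed.

(** For [|t| <= tau] the powers of [|t| / tau] decrease, so one value of the majorant controls the
    whole tail, whatever the degree of [p]. *)
Lemma majorant_horner_tail p P n (t tau : R) : majorant p P -> 0 < tau ->
  `|t| <= tau -> `|p.[t] - (take_poly n p).[t]| <= P.[tau] * (`|t| / tau) ^+ n.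
Proof.
move=> pP tau0 tt; pose N := maxn (size p) (size P).
have -> : p.[t] - (take_poly n p).[t] = \sum_(i < N) (if (i < n)%N then 0 else p`_i * t ^+ i).
  rewrite (@horner_coef_wide _ N p) ?leq_maxl//.
  rewrite (@horner_coef_wide _ N (take_poly n p)); last first.
    apply: leq_trans (leq_maxl _ _); apply/leq_sizeP => j pj; rewrite coef_take_poly.
    by case: ifP => // _; move: pj => /leq_sizeP; exact.
  rewrite -sumrB; apply: eq_bigr => i _; rewrite coef_take_poly.
  by case: ifP => _; [rewrite subrr|rewrite mul0r subr0].
rewrite (@horner_coef_wide _ N P) ?leq_maxr// mulr_suml.
apply: le_trans (ler_norm_sum _ _ _) _; apply: ler_sum => i _.
have q0 : 0 <= `|t| / tau by rewrite divr_ge0// ltW.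
case: ifP => [_|/negbT]; rewrite -?leqNgt.
  by rewrite normr0 !mulr_ge0 ?exprn_ge0 ?(majorant_ge0 _ pP)// ltW.
move=> ni; rewrite normrM -mulrA ler_pM// normrX.
have -> : `|t| ^+ i = tau ^+ i * (`|t| / tau) ^+ i.
  by rewrite -exprMn mulrCA divff ?mulr1// gt_eqF.
rewrite ler_wpM2l ?exprn_ge0 ?(ltW tau0)//.
have q1 : `|t| / tau <= 1 by rewrite ler_pdivrMr// mul1r.
exact: (ler_wiXn2l q0 q1 ni).
Qed.

(* The value at [h] of a polynomial of degree at most [m] is a fixed linear
   combination of its values at [0, -h, ..., -m h]. *)
Lemma extrapolation m : exists2 C : R, 0 <= C & forall (q : {poly R}) (h B : R),
  (size q <= m.+1)%N -> 0 < h -> (forall k : nat, (k <= m)%N -> `|q.[- (k%:R * h)]| <= B) ->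
  `|q.[h]| <= C * B.
Proof.
elim: m => [|m [C C0 HC]].
  exists 1 => // q h B /size1_polyC -> h0 /(_ 0%N isT); rewrite mul1r.
  by rewrite !hornerC.
(* Subtract the value at the last node -(m+1)h and divide by the linear factor vanishing there. The
   nodes being at least h apart, the quotient is at most 2B/h at the others; at h the factor is
   (m+2)h. *)
exists (1 + 2 * C * m.+2%:R) => [|q h B sq h0 qB]; first by rewrite addr_ge0// !mulr_ge0.
pose x : R := - (m.+1%:R * h); pose b := q.[x].
have bB : `|b| <= B by exact: qB.
have /factor_theorem[s sE] : root (q - b%:P) x by rewrite /root !hornerE subrr.
have qE y : q.[y] = b + s.[y] * (y - x).
  by have := congr1 (fun p => p.[y]) sE; rewrite !hornerE => <-; ring.
have ss : (size s <= m.+1)%N.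
  have [->|s0] := eqVneq s 0; first by rewrite size_poly0.
  have : (size (q - b%:P)%R <= m.+2)%N.
    rewrite (leq_trans (size_polyD _ _))// geq_max sq size_polyN.
    by rewrite (leq_trans (size_polyC_leq1 _)).
  by rewrite sE size_Mmonic ?monicXsubC// size_XsubC addn2.
have sB : `|s.[h]| <= C * (2 * B / h).
  apply: HC => // k km; rewrite ler_pdivlMr//.
  have := qE (- (k%:R * h)); rewrite /x opprK => qk.
  have kp : 1 <= m.+1%:R - k%:R :> R by rewrite -natrB ?(leq_trans km)// ler1n subn_gt0.
  have e1 : s.[- (k%:R * h)] * ((m.+1%:R - k%:R) * h) = q.[- (k%:R * h)] - b.
    by rewrite qk; ring.
  have : `|s.[- (k%:R * h)]| * ((m.+1%:R - k%:R) * h) <= 2 * B.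
    rewrite -[X in _ * X]ger0_norm ?mulr_ge0 ?(ltW h0) ?(le_trans ler01)//.
    rewrite -normrM e1 (le_trans (ler_normB _ _))// mulr2n mulrDl mul1r lerD// qB//.
    exact: leq_trans km _.
  apply: le_trans; rewrite ler_wpM2l// -[leLHS]mul1r ler_wpM2r// ltW//.
rewrite qE (le_trans (ler_normD _ _))// mulrDl mul1r lerD// normrM.
have -> : `|h - x| = m.+2%:R * h.
  rewrite /x opprK ger0_norm; first by rewrite -(natr1 m.+1); ring.
  by rewrite addr_ge0 ?mulr_ge0 // ltW.
apply: le_trans (ler_wpM2r _ sB) _; first by rewrite mulr_ge0// ltW.
by rewrite le_eqVlt; apply/orP; left; apply/eqP; field; rewrite gt_eqF.
Qed.

End Majorants.

(** * Power series in several variables *)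

Section PowerSeries.
Context {R : realType} {d : nat}.
Notation E := 'rV[R]_d.
Notation e_ i := (delta_mx 0 i : E).
Notation multi := {ffun 'I_d -> nat}.
Local Open Scope fset_scope.
Local Open Scope ring_scope.
Implicit Types (al be : multi) (z w : E).

Definition mono al z : R := \prod_i z 0 i ^+ al i.
Definition mdegree al : nat := (\sum_i al i)%N.

Lemma mono_word al z : mono al z = \prod_(i <- word_of al) z 0 i.
Proof.
rewrite /mono /word_of big_flatten/= big_map big_enum/=; apply: eq_bigr => i _.
by rewrite big_nseq iter_mulr_1.
Qed.

Lemma prod_seq_lipschitz (s : seq 'I_d) z w rho : `|z| <= rho -> `|w| <= rho ->
  `|\prod_(i <- s) z 0 i - \prod_(i <- s) w 0 i| <=
    (size s)%:R * rho ^+ (size s).-1 * `|z - w|.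
Proof.
move=> zr wr; have r0 : 0 <= rho by exact: le_trans zr.
have zwi i : `|z 0 i - w 0 i| <= `|z - w|.
  by have := le_coord_norm (z - w) i; rewrite !mxE.
have prho (u : seq 'I_d) : `|\prod_(i <- u) z 0 i| <= rho ^+ size u.
  elim: u => [|i u IH]; first by rewrite big_nil normr1.
  by rewrite big_cons normrM exprS ler_pM// (le_trans (le_coord_norm _ _)).
elim: s => [|i s IH]; first by rewrite !big_nil subrr normr0 !mul0r.
rewrite !big_cons.
set p := \prod_(j <- s) z 0 j; set q := \prod_(j <- s) w 0 j.
have -> : z 0 i * p - w 0 i * q = (z 0 i - w 0 i) * p + w 0 i * (p - q) by ring.
rewrite (le_trans (ler_normD _ _))// !normrM /= -natr1 mulrDl mul1r mulrDl addrC lerD//.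
  have h : `|w 0 i| <= rho by rewrite (le_trans (le_coord_norm _ _)).
  apply: le_trans (ler_pM _ _ h IH) _ => //.
  case: (size s) => [|n] /=; first by rewrite !mul0r mulr0.
  by rewrite exprS !mulrA [rho * _]mulrC.
by rewrite [leRHS]mulrC ler_pM// prho.
Qed.

Lemma mono_lipschitz al z w rho : `|z| <= rho -> `|w| <= rho ->
  `|mono al z - mono al w| <= (mdegree al)%:R * rho ^+ (mdegree al).-1 * `|z - w|.
Proof.
by move=> zr wr; rewrite !mono_word /mdegree -(size_word_of al) prod_seq_lipschitz.
Qed.

Definition has_series (u : E -> R) (a : E) (r : R) (c : multi -> R) : Prop :=
  forall x, `|x - a| < r ->
    partial_sum (fun al => c al * mono al (x - a)) @ totally --> u x.

Definition abs_bound (c : multi -> R) (rho B : R) : Prop :=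
  forall J : {fset multi}, \sum_(al <- J) `|c al| * rho ^+ mdegree al <= B.

(** At the corner [a + const_mx rho] of the cube each monomial equals [rho] to its degree, so
    absolute convergence at this single point suffices. *)
Lemma series_abs_bound u a r c rho : has_series u a r c -> 0 <= rho -> rho < r ->
  exists2 B, 0 <= B & abs_bound c rho B.
Proof.
move=> uc r0 rr; pose x := a + const_mx rho.
have xa : x - a = const_mx rho by rewrite addrC addKr.
have xr : `|x - a| < r.
  by rewrite xa (le_lt_trans _ rr)// row_norm_le// => i; rewrite mxE ger0_norm.
have [B B0 HB] := cvg_totally_abs_bounded (uc x xr).
exists B => // J; apply: le_trans (HB J); apply: ler_sum => al _.
rewrite normrM xa /mono; under [in leRHS]eq_bigr do rewrite mxE.
by rewrite prodrXr -/(mdegree al) [X in _ <= _ * X]ger0_norm// exprn_ge0.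
Qed.

(** Termwise comparison of a series with a finite sum. The weights [Phi] are monomials or
    differences of two monomials; the retained indices [beta i] carry the main part. *)
Lemma series_dominated (c Phi : multi -> R) (l rho B eps : R) (I : finType)
    (beta : I -> multi) (v : I -> R) :
  partial_sum (fun al => c al * Phi al) @ totally --> l ->
  abs_bound c rho B -> 0 <= rho -> 0 <= eps ->
  (forall al, `|Phi al - \sum_i (if al == beta i then v i else 0)| <= eps * rho ^+ mdegree al) ->
  `|l - \sum_i c (beta i) * v i| <= eps * B.
Proof.
move=> cl cB rho0 eps0 HPhi.
apply: (cvg_totally_le (J0 := [fset beta i | i : I])) cl _ => J sJ.
have -> : \sum_i c (beta i) * v i =
    \sum_(al <- J) c al * \sum_i (if al == beta i then v i else 0).
  under [RHS]eq_bigr do rewrite mulr_sumr.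
  rewrite exchange_big/=; apply: eq_bigr => i _.
  have bJ : beta i \in J by apply: (fsubsetP sJ); apply: in_imfset.
  rewrite (big_fsetD1 (beta i))//= eqxx big_seq big1 ?addr0// => al.
  by rewrite !inE => /andP[/negbTE -> _]; rewrite mulr0.
rewrite -sumrB; apply: le_trans (ler_norm_sum _ _ _) _.
apply: (@le_trans _ _ (eps * \sum_(al <- J) `|c al| * rho ^+ mdegree al)); last exact: ler_wpM2l.
rewrite mulr_sumr; apply: ler_sum => al _.
by rewrite -mulrBr normrM mulrCA ler_wpM2l.
Qed.

Definition unit_index (i : 'I_d) : multi := [ffun j => (j == i : nat)].

Lemma mono_unit i z : mono (unit_index i) z = z 0 i.
Proof.
rewrite /mono (bigD1 i)//= ffunE eqxx expr1 big1 ?mulr1// => j ji.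
by rewrite ffunE (negbTE ji) expr0.
Qed.

Lemma mdegree0 al : mdegree al = 0%N -> al = [ffun=> 0%N].
Proof.
move=> /eqP; rewrite /mdegree sum_nat_eq0 => /forallP h.
by apply/ffunP => i; rewrite ffunE; apply/eqP; exact: (implyP (h i)).
Qed.

Lemma mdegree_unit i : mdegree (unit_index i) = 1%N.
Proof.
rewrite /mdegree (bigD1 i)//= ffunE eqxx big1// => j ji.
by rewrite ffunE (negbTE ji).
Qed.

Lemma mdegree1 al : mdegree al = 1%N -> exists i, al = unit_index i.
Proof.
move=> h; have [i ai] : exists i, al i != 0%N.
  apply/existsP; apply: contraPT h => /existsPn h.
  by rewrite /mdegree big1// => i _; apply/eqP; move: (h i); rewrite negbK.
exists i; move: h ai; rewrite /mdegree (bigD1 i)//=; set N := (\sum_(_ < _ | _) _)%N.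
case ai : (al i) => [|[|n]] // + _.
rewrite add1n => -[] /eqP; rewrite sum_nat_eq0 => /forallP h.
apply/ffunP => j; rewrite ffunE; have [->//|ji] := eqVneq j i.
by apply/eqP; have := h j; rewrite ji.
Qed.

Lemma unit_index_inj : injective unit_index.
Proof.
move=> i j /ffunP/(_ i); rewrite !ffunE eqxx; by case: eqP.
Qed.

(** Both points vary near the centre: this strict form gives Lipschitz bounds and monotonicity
    around [a] from the coefficients at [a] alone, without expanding the series elsewhere. *)
Lemma strict_differentiability u a r c : has_series u a r c -> 0 < r ->
  exists C : R, 0 < C /\ forall (rho : R) x y, 0 < rho -> rho <= r / 4 ->
    `|x - a| <= rho -> `|y - a| <= rho ->
    `|u y - u x - \sum_i c (unit_index i) * (y - x) 0 i| <= C * rho * `|y - x|.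
Proof.
move=> uc r0; pose rh := r / 2; have rh0 : 0 < rh by rewrite divr_gt0.
have [B B0 cB] := @series_abs_bound u a r c rh uc (ltW rh0) ltac:(rewrite /rh; lra).
have rhE : rh = r / 2 by []; clearbody rh.
exists (4 / rh ^+ 2 * B + 1); split=> [|rho x y rho0 rho1 xr yr].
  by rewrite ltr_wpDl// mulr_ge0// divr_ge0// exprn_ge0// ltW.
have xr' : `|x - a| < r by lra.
have yr' : `|y - a| < r by lra.
have cl : partial_sum (fun al => c al * (mono al (y - a) - mono al (x - a)))
    @ totally --> u y - u x.
  have -> : partial_sum (fun al => c al * (mono al (y - a) - mono al (x - a))) =
      partial_sum (fun al => c al * mono al (y - a)) \-
      partial_sum (fun al => c al * mono al (x - a)).
    apply/funext => J; rewrite /= !partial_sumE -sumrB.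
    by apply: eq_bigr => al _; rewrite mulrBr.
  by apply: cvgB; exact: uc.
have key al : `|(mono al (y - a) - mono al (x - a)) -
     \sum_i (if al == unit_index i then (y - x) 0 i else 0)|
     <= (4 / rh ^+ 2 * rho * `|y - x|) * rh ^+ mdegree al.
  have p0 : 0 <= (4 / rh ^+ 2 * rho * `|y - x|) * rh ^+ mdegree al.
    by rewrite !mulr_ge0 ?invr_ge0 ?exprn_ge0 ?(ltW rho0) ?(ltW rh0).
  have [d0|d0] := eqVneq (mdegree al) 0%N.
    rewrite big1 => [|i _]; last first.
      case: eqP => // ai; move: d0; rewrite ai mdegree_unit => //.
    rewrite [X in `|X|](_ : _ = 0) ?normr0// (mdegree0 d0) /mono.
    by rewrite !big1 ?subrr ?subr0// => i _; rewrite ffunE expr0.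
  have [d1|d1] := eqVneq (mdegree al) 1%N.
    have [i ai] := mdegree1 d1; rewrite (bigD1 i)//= ai eqxx big1 => [|j ji]; last first.
      by case: eqP => // /unit_index_inj ij; rewrite ij eqxx in ji.
    rewrite [X in `|X|](_ : _ = 0); first by rewrite normr0 -ai.
    by rewrite !mono_unit !mxE; ring.
  rewrite big1 => [|i _]; last first.
    by case: eqP => // ai; move: d1; rewrite ai mdegree_unit.
  rewrite subr0 (le_trans (mono_lipschitz al yr xr))//.
  have -> : y - a - (x - a) = y - x by apply/rowP => j; rewrite !mxE; ring.
  rewrite -!mulrA [ `|y - x| * _]mulrC !mulrA ler_wpM2r//.
  case: (mdegree al) d0 d1 => [|[|n]]// _ _; rewrite [n.+2.-1]/=.
  have -> : rh ^+ n.+2 = rh ^+ 2 * rh ^+ n by rewrite -exprD.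
  have -> : 4 / rh ^+ 2 * rho * (rh ^+ 2 * rh ^+ n) = (4 * rh ^+ n) * rho.
    by field; rewrite gt_eqF.
  rewrite exprSr mulrA.
  rewrite ler_wpM2r ?(ltW rho0)//.
  (* Half the radius absorbs the factor n + 2 given by [mono_lipschitz]: (n + 2) / 2^n <= 4. *)
  have rr : rho <= rh / 2 by rewrite rhE; lra.
  have : rho ^+ n <= (rh / 2) ^+ n by rewrite lerXn2r// nnegrE ?divr_ge0 ?ltW.
  move=> /(ler_wpM2l (ler0n R n.+2)) /le_trans; apply.
  rewrite expr_div_n mulrCA mulrC ler_wpM2r ?exprn_ge0 ?(ltW rh0)//.
  rewrite ler_pdivrMr ?exprn_gt0// -natrX -natrM ler_nat -[4%N]/(2 ^ 2)%N -expnD addnC.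
  by rewrite addn2; exact: ltnW (ltn_expl n.+2 (isT : 1 < 2)%N).
have e0 : 0 <= 4 / rh ^+ 2 * rho * `|y - x|.
  by rewrite !mulr_ge0 ?invr_ge0 ?exprn_ge0 ?(ltW rho0) ?(ltW rh0).
have := series_dominated cl cB (ltW rh0) e0 key.
move/le_trans; apply.
set X := 4 / _; have -> : (X * B + 1) * rho * `|y - x| = X * rho * `|y - x| * B + rho * `|y - x|.
  by ring.
by rewrite lerDl mulr_ge0// ltW.
Qed.

(** Only the powers of the k-th variable survive on the axis, so [q] is a Taylor polynomial. Applied
    to an inverse chart, it supplies the curve of [has_curve]. *)
Lemma axis_expansion u a r c m k : has_series u a r c -> 0 < r ->
  exists q : {poly R}, [/\ (size q <= m.+1)%N, (0 < m)%N -> q`_1 = c (unit_index k), q`_0 = u a &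
    exists2 C, 0 <= C & forall t, `|t| <= r / 2 ->
      `|u (a + t *: e_ k) - q.[t]| <= C * `|t| ^+ m.+1].
Proof.
move=> uc r0; pose rh := r / 2; have rh0 : 0 < rh by rewrite divr_gt0.
have [B B0 cB] := @series_abs_bound u a r c rh uc (ltW rh0) ltac:(rewrite /rh; lra).
pose beta (n : nat) : multi := [ffun j => if j == k then n else 0%N].
have beta_deg n : mdegree (beta n) = n.
  rewrite /mdegree (bigD1 k)//= ffunE eqxx big1 ?addn0// => j jk.
  by rewrite ffunE (negbTE jk).
have mono_axis al t : mono al (t *: e_ k) = if al == beta (al k) then t ^+ al k else 0.
  rewrite /mono (bigD1 k)//= !mxE !eqxx mulr1.
  case: eqP => [ab|nab].
    rewrite big1 ?mulr1// => j jk; rewrite ab ffunE (negbTE jk) expr0 //.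
  have [j jk aj] : exists2 j, j != k & al j != 0%N.
    apply/exists_inP; apply: contra_notT nab => /exists_inPn h.
    apply/ffunP => j; rewrite ffunE; case: (eqVneq j k) => [->//|jk].
    by apply/eqP; have := h j jk; rewrite negbK.
  by rewrite (bigD1 j)//= !mxE eqxx/= (negbTE jk) mulr0 expr0n (negbTE aj) mul0r mulr0.
pose q : {poly R} := \poly_(n < m.+1) c (beta n).
have Cq : exists2 C, 0 <= C & forall t, `|t| <= r / 2 ->
      `|u (a + t *: e_ k) - q.[t]| <= C * `|t| ^+ m.+1.
  exists (rh ^- m.+1 * B) => [|t tr]; first by rewrite mulr_ge0// invr_ge0 exprn_ge0// ltW.
  have xr : `|(a + t *: e_ k) - a| < r.
    by rewrite addrC addKr normrZ norm_delta mulr1; lra.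
  have e0 : 0 <= (`|t| / rh) ^+ m.+1 by rewrite exprn_ge0// divr_ge0// ltW.
  rewrite horner_poly; have := series_dominated (v := fun n : 'I_m.+1 => t ^+ n)
      (beta := fun n : 'I_m.+1 => beta n) (uc _ xr) cB (ltW rh0) e0.
  rewrite expr_div_n mulrAC -mulrA [_ * B]mulrC => /(_ _)/le_trans; apply=> //.
    move=> al; rewrite [a + _]addrC addrK mono_axis.
    have p0 : 0 <= `|t| ^+ m.+1 / rh ^+ m.+1 * rh ^+ mdegree al.
      by rewrite mulr_ge0 ?divr_ge0 ?exprn_ge0// ltW.
    case: (eqVneq al (beta (al k))) => [ab|nab]; last first.
      rewrite big1 ?subrr ?normr0// => n _; case: eqP => // an; move: nab.
      by rewrite an ffunE eqxx eqxx.
    have degE : mdegree al = al k by rewrite {1}ab beta_deg.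
    have [km|mk] := ltnP (al k) m.+1.
      rewrite (bigD1 (Ordinal km))//= -ab eqxx big1 ?addr0 ?subrr ?normr0// => n nk.
      case: eqP => // an; move: nk; rewrite -val_eqE/= an ffunE eqxx eqxx //.
    rewrite big1 => [|n _]; last first.
      by case: eqP => // an; move: mk; rewrite an ffunE eqxx leqNgt ltn_ord.
    rewrite subr0 normrX degE -expr_div_n.
    have -> : `|t| ^+ al k = (`|t| / rh) ^+ al k * rh ^+ al k.
      by rewrite expr_div_n divfK// expf_neq0// gt_eqF.
    rewrite ler_wpM2r ?exprn_ge0 ?(ltW rh0)//.
    have q0 : 0 <= `|t| / rh by rewrite divr_ge0// ltW.
    have q1 : `|t| / rh <= 1 by rewrite ler_pdivrMr// mul1r.
    exact: (ler_wiXn2l q0 q1 mk).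
  by rewrite [leRHS]mulrC !mulrA.
exists q; split=> //.
- exact: size_poly.
- by move=> m0; rewrite coef_poly ltnS m0.
have [C _ /(_ 0)] := Cq; rewrite normr0 expr0n/= mulr0 scale0r addr0 horner_coef0.
by move=> /(_ ltac:(lra)); rewrite normr_le0 subr_eq0 => /eqP.
Qed.

Definition curve (P : 'I_d -> {poly R}) (t : R) : E := \row_i (P i).[t].

(** [K] does not depend on [P]. Each finite partial sum of the series becomes a polynomial in t
    along the curve, with a majorant whose value at [tau] has a common bound. Truncating at degree m
    thus costs O(h^(m+1)) uniformly, and [extrapolation] applies to the truncation. This avoids
    rearranging the composed series. *)
Lemma polynomial_curve_extrapolation u p r c m (M : R) : has_series u p r c -> 0 < r ->
  exists2 K : R, 0 < K & forall P : 'I_d -> {poly R},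
    (forall i, (size (P i) <= m.+1)%N) -> (forall i n, `|(P i)`_n| <= M) ->
    `|curve P 0 - p| <= r / 4 ->
    forall h B, 0 < h -> h * K <= 1 ->
      (forall k : nat, (k <= m)%N -> `|u (curve P (- (k%:R * h)))| <= B) ->
      `|u (curve P h)| <= K * (B + h ^+ m.+1).
Proof.
move=> uc r0; pose rh := r / 2; have rh0 : 0 < rh by rewrite divr_gt0.
have [B0 B00 cB] := @series_abs_bound u p r c rh uc (ltW rh0) ltac:(rewrite /rh; lra).
have [C C0 HC] := @extrapolation R m.
pose Z := m.+1%:R * `|M| + 1; have Z0 : 0 < Z by rewrite ltr_wpDl// mulr_ge0.
pose tau := Num.min 1 (r / 4 / Z).
have tau0 : 0 < tau by rewrite lt_min ltr01/= !divr_gt0.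
have tau1 : tau <= 1 by rewrite ge_min lexx.
have tauZ : tau * Z <= r / 4 by rewrite -ler_pdivlMr// ge_min lexx orbT.
(* A common majorant for the coordinates of the curve relative to [p]: r/4 bounds the position at
   time 0, |M| the other coefficients. [tau] is chosen to make its value at most r/2. *)
pose Q : {poly R} := (r / 4)%:P + \poly_(i < m.+1) (if i == 0%N then 0 else `|M|).
have Qtau : Q.[tau] <= rh.
  rewrite /Q hornerD hornerC horner_poly.
  have : \sum_(i < m.+1) (if i == 0%N :> nat then 0 else `|M|) * tau ^+ i <=
         \sum_(i < m.+1) `|M| * tau.
    apply: ler_sum => -[[|i] im] _ /=; first by rewrite mul0r mulr_ge0// ltW.
    by rewrite ler_wpM2l// exprS ler_piMr ?(ltW tau0)// exprn_ile1// ltW.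
  rewrite sumr_const card_ord -[_ *+ m.+1]mulr_natl mulrA => h.
  have : m.+1%:R * `|M| * tau <= r / 4.
    by apply: le_trans tauZ; rewrite mulrC ler_wpM2l ?(ltW tau0)// /Z lerDl.
  by rewrite /rh; lra.
pose V := (m.+1%:R / tau).
have V0 : 0 < V by rewrite divr_gt0// ltr0n.
have CV0 : 0 <= (C + 1) * (B0 * V ^+ m.+1).
  by rewrite mulr_ge0 ?mulr_ge0 ?exprn_ge0 ?(ltW V0)//; lra.
(* The summand [V] lets [h * K <= 1] imply (m+1)h <= tau, which keeps all the nodes in range. *)
exists (C + (C + 1) * (B0 * V ^+ m.+1) + V + 1).
  by move: CV0 V0 C0; lra.
move=> P sP MP P0 h B h0 hK uB.
have hV : m.+1%:R * h <= tau.
  have : h * V <= 1.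
    apply: le_trans hK; rewrite ler_wpM2l ?(ltW h0)//.
    by move: CV0 V0 C0; lra.
  by rewrite /V mulrA ler_pdivrMr// mul1r mulrC.
have maj i : majorant (P i - (p 0 i)%:P) Q.
  move=> [|n]; rewrite coefB coefC/= coefD coefC coef_poly/=.
    rewrite addr0 -horner_coef0; apply: le_trans P0.
    by have := le_coord_norm (curve P 0 - p) i; rewrite !mxE.
  rewrite subr0 add0r; case: ifP => [_|/negbT]; first by rewrite (le_trans (MP _ _))// ler_norm.
  rewrite -leqNgt => nm; rewrite nth_default ?normr0//; exact: leq_trans (sP i) nm.
pose S (J : {fset multi}) : {poly R} :=
  \sum_(al <- J) c al *: \prod_(i <- word_of al) (P i - (p 0 i)%:P).
have SE J t : (S J).[t] = \sum_(al <- J) c al * mono al (curve P t - p).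
  rewrite /S horner_sum; apply: eq_bigr => al _; rewrite hornerZ mono_word horner_prod.
  by congr (_ * _); apply: eq_bigr => i _; rewrite !hornerE !mxE.
pose T (J : {fset multi}) : {poly R} := \sum_(al <- J) `|c al| *: Q ^+ mdegree al.
have ST J : majorant (S J) (T J).
  apply: majorant_sum => al; apply: majorantZ.
  by rewrite /mdegree -(size_word_of al); apply: majorant_prod_seq => i; exact: maj.
have Qge0 : 0 <= Q.[tau].
  rewrite /Q hornerD hornerC horner_poly; apply: addr_ge0.
    by rewrite divr_ge0// ltW.
  by apply: sumr_ge0 => i _; case: ifP => _; rewrite mulr_ge0// exprn_ge0// ltW.
have Ttau J : (T J).[tau] <= B0.
  rewrite /T horner_sum; apply: le_trans (cB J); apply: ler_sum => al _.
  by rewrite hornerZ horner_exp ler_wpM2l// lerXn2r// nnegrE// ltW.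
have curve_in t : `|t| <= tau -> `|curve P t - p| < r.
  move=> tt; apply: (@le_lt_trans _ _ rh); last by rewrite /rh; lra.
  apply: row_norm_le => [|i]; first exact: ltW.
  have := @majorant_horner_tail _ _ _ 0 _ _ (maj i) tau0 tt.
  rewrite expr0 mulr1 (_ : take_poly 0 _ = 0) ?horner0 ?subr0; last first.
    by apply/polyP => n; rewrite coef_take_poly coef0.
  rewrite hornerD hornerN hornerC !mxE => h1.
  exact: le_trans h1 Qtau.
have tail J t : `|t| <= tau ->
    `|(S J).[t] - (take_poly m.+1 (S J)).[t]| <= B0 * (`|t| / tau) ^+ m.+1.
  move=> tt; apply: le_trans (majorant_horner_tail m.+1 (ST J) tau0 tt) _.
  by rewrite ler_wpM2r// exprn_ge0// divr_ge0// ltW.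
have tailV J (k : nat) (t : R) : (k <= m.+1)%N -> `|t| = k%:R * h ->
    `|(S J).[t] - (take_poly m.+1 (S J)).[t]| <= B0 * V ^+ m.+1 * h ^+ m.+1.
  move=> km tE; have kh : k%:R * h <= m.+1%:R * h by rewrite ler_wpM2r ?ler_nat ?ltW.
  apply: le_trans (tail J t _) _; first by rewrite tE (le_trans kh).
  have q0 : 0 <= `|t| / tau by rewrite divr_ge0// ltW.
  have q1 : 0 <= V * h by rewrite mulr_ge0// ltW.
  rewrite -mulrA -exprMn ler_wpM2l// lerXn2r//.
  have -> : V * h = m.+1%:R * h / tau by rewrite /V mulrAC.
  by rewrite tE ler_wpM2r ?invr_ge0 ?(ltW tau0).
have tin (k : nat) (t : R) : (k <= m.+1)%N -> `|t| = k%:R * h -> `|t| <= tau.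
  move=> km ->; apply: le_trans hV; by rewrite ler_wpM2r ?ler_nat ?ltW.
have hh : `|h| = 1%:R * h by rewrite mul1r gtr0_norm.
have kh (k : nat) : `|- (k%:R * h)| = k%:R * h by rewrite normrN ger0_norm// mulr_ge0// ltW.
(* At the m + 2 points involved, [u] is replaced by one partial sum, up to [eta]; the total error (C
   + 1) eta is the arbitrary [d']. *)
apply/ler_addgt0Pr => d' d'0.
pose eta := d' / (C + 1); have eta0 : 0 < eta by rewrite divr_gt0//; lra.
pose s : seq R := h :: [seq - (k%:R * h) | k <- iota 0 m.+1].
have [J0 _ /(_ J0 (fsubset_refl _)) HJ] :
    (@totally multi) [set J | forall t, t \in s -> `|(S J).[t] - u (curve P t)| < eta].
  apply: totally_all => t ts.
  have tt : `|t| <= tau.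
    move: ts; rewrite inE => /predU1P[->|]; first exact: (tin 1%N).
    by move=> /mapP[k]; rewrite mem_iota add0n => /andP[_ km] ->; apply: (tin k) => //; exact: ltnW.
  have [J1 H1] := cvg_totally_ball (uc _ (curve_in _ tt)) eta0.
  by exists J1 => // J J1J /=; rewrite SE; exact: H1.
pose L := take_poly m.+1 (S J0).
pose W := B0 * V ^+ m.+1 * h ^+ m.+1.
have Lk (k : nat) : (k <= m)%N -> `|L.[- (k%:R * h)]| <= B + eta + W.
  move=> km; have h1 := uB k km.
  have h2 := tailV J0 k _ (leqW km) (kh k).
  have h3 : `|(S J0).[- (k%:R * h)] - u (curve P (- (k%:R * h)))| < eta.
    by apply: HJ; rewrite inE; apply/orP; right; apply/mapP; exists k; rewrite ?mem_iota.
  move: h1 h2 h3; rewrite -/L -/W; clear.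
  by rewrite !ler_norml ltr_norml => /andP[? ?] /andP[? ?] /andP[? ?]; apply/andP; split; lra.
have Lh := HC L h _ (size_take_poly _ _) h0 Lk.
have h2 := tailV J0 1%N h isT hh.
have h3 : `|(S J0).[h] - u (curve P h)| < eta by apply: HJ; rewrite mem_head.
have : `|u (curve P h)| <= C * (B + eta + W) + eta + W.
  move: Lh h2 h3; rewrite -/L -/W; clear; set X := C * _.
  by rewrite !ler_norml ltr_norml => /andP[? ?] /andP[? ?] /andP[? ?]; apply/andP; split; lra.
move/le_trans; apply.
have B_ge0 : 0 <= B by apply: le_trans (uB 0%N isT).
have hm0 : 0 <= h ^+ m.+1 by rewrite exprn_ge0// ltW.
have etaE : (C + 1) * eta = d' by rewrite /eta mulrC divfK// gt_eqF//; lra.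
have e1 : 0 <= ((C + 1) * (B0 * V ^+ m.+1) + V + 1) * B by rewrite mulr_ge0//; lra.
have e2 : 0 <= (C + V + 1) * h ^+ m.+1 by rewrite mulr_ge0//; lra.
have -> : (C + (C + 1) * (B0 * V ^+ m.+1) + V + 1) * (B + h ^+ m.+1) + d' =
   C * (B + eta + W) + eta + W + ((C + 1) * (B0 * V ^+ m.+1) + V + 1) * B +
   (C + V + 1) * h ^+ m.+1.
  by rewrite -etaE /W; ring.
by rewrite -[leRHS]addrA lerDl addr_ge0.
Qed.

End PowerSeries.

(** * Quantitative properties of analytic hypersurfaces, from their charts *)

Section Charts.
Context {R : realType} {d : nat}.
Notation E := 'rV[R]_d.
Notation e_ i := (delta_mx 0 i : E).
Notation multi := {ffun 'I_d -> nat}.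

Lemma analytic_has_series (U : set E) (f : E -> E) a : analytic_on U f -> U a ->
  exists2 r : R, 0 < r &
    exists c : 'I_d -> multi -> R, forall j, has_series (fun x => f x 0 j) a r (c j).
Proof.
move=> fU Ua; have [c [r [r0 Hr]]] := fU a Ua; exists r => //.
exists (fun j al => c al 0 j) => j x xa.
have bx : ball a r x by rewrite mx_norm_ball /ball_/= distrC.
have := Hr x bx => h.
have -> : partial_sum (fun al => c al 0 j * mono al (x - a)) =
   (fun y : E => y 0 j) \o
   partial_sum (fun al : multi => (\prod_i (x 0 i - a 0 i) ^+ al i) *: c al).
  apply/funext => J; rewrite /= !partial_sumE summxE; apply: eq_bigr => al _.
  rewrite mxE mulrC /mono; congr (_ * _); apply: eq_bigr => i _; by rewrite !mxE.
by apply: (cvg_comp _ _ h); exact: coord_continuous.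
Qed.

Lemma ball_subset_open (U : set E) p : open U -> U p ->
  exists2 r : R, 0 < r & forall x, `|x - p| < r -> U x.
Proof.
rewrite openE => oU /oU /nbhs_normP[r /= r0 Hr]; exists r => // x xp.
by apply: Hr; rewrite /= distrC.
Qed.

Lemma series_lipschitz (f : E -> E) a r (c : 'I_d -> multi -> R) : 0 < r ->
  (forall j, has_series (fun x => f x 0 j) a r (c j)) ->
  exists2 L : R, 0 < L & forall x y, `|x - a| <= r / 4 -> `|y - a| <= r / 4 ->
    `|f x - f y| <= L * `|x - y|.
Proof.
move=> r0 fc; have /boolp.choice[C HC] := fun j => strict_differentiability (fc j) r0.
pose L := \sum_j (C j * (r / 4) + \sum_i `|c j (unit_index i)|) + 1.
have t0 j : 0 <= C j * (r / 4) + \sum_i `|c j (unit_index i)|.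
  have [Cj _] := HC j.
  by rewrite addr_ge0 ?sumr_ge0// mulr_ge0 ?divr_ge0 ?ltW.
exists L => [|x y xa ya]; first by rewrite ltr_wpDl ?sumr_ge0.
apply: row_norm_le => [|j]; first by rewrite mulr_ge0// addr_ge0// sumr_ge0.
rewrite !mxE; have [Cj /(_ (r / 4) y x) H] := HC j.
have := H ltac:(lra) ltac:(lra) ya xa => {}H.
have Lj : C j * (r / 4) + \sum_i `|c j (unit_index i)| <= L.
  by rewrite ler_wpDr// [leRHS](bigD1 j)//= lerDl sumr_ge0.
apply: le_trans (ler_wpM2r (normr_ge0 _) Lj).
have := ler_normD (f x 0 j - f y 0 j - \sum_i c j (unit_index i) * (x - y) 0 i)
   (\sum_i c j (unit_index i) * (x - y) 0 i).
rewrite subrK => /le_trans; apply; rewrite mulrDl lerD//.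
rewrite mulr_suml (le_trans (ler_norm_sum _ _ _))//; apply: ler_sum => i _.
by rewrite normrM ler_wpM2l// le_coord_norm.
Qed.

(** Replaces the chain rule for a chart and its inverse: were the relevant linear part zero, a
    displacement of size t would be O(t^2). *)
Lemma quadratic_contra (K t0 : R) : 0 < t0 ->
  (forall t, 0 < t -> t <= t0 -> t <= K * t ^+ 2) -> False.
Proof.
move=> t00 H; pose t := Num.min t0 (1 / (2 * (`|K| + 1))).
have K1 : 0 < `|K| + 1 by rewrite ltr_wpDl.
have t_gt0 : 0 < t by rewrite lt_min t00/= divr_gt0// mulr_gt0.
have := H t t_gt0; rewrite ge_min lexx => /(_ isT).
have t1 : t * (2 * (`|K| + 1)) <= 1.
  by rewrite -ler_pdivlMr ?mulr_gt0// ge_min lexx orbT.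
have : K * t ^+ 2 <= `|K| * t * t by rewrite expr2 mulrA !ler_wpM2r ?ler_norm// ltW.
have := normr_ge0 K; move: (`|K|) t1 t_gt0 => k; clear; nra.
Qed.

Section Tame.
Variable m : nat.
Implicit Types (S : set E) (q : E) (rho M n : R) (a : 'I_d).

(* [u] is an equation of [S] near [q], strictly monotone along [e_a], for which
   extrapolation along polynomial curves from [0, -h, ..., -m h] to [h] has an
   error [O(h^(m+1))]. *)
Definition tame q rho M n a S : Prop := exists u : E -> R,
  [/\ forall x, `|x - q| < 2 * rho -> S x -> u x = 0,
      forall x y, `|x - q| < 2 * rho -> `|y - q| < 2 * rho -> `|u x - u y| <= n * `|x - y|,
      forall x (s : R), `|x - q| < 2 * rho -> `|x + s *: e_ a - q| < 2 * rho ->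
        `|s| <= n * `|u (x + s *: e_ a) - u x| &
      forall P : 'I_d -> {poly R},
        (forall i, (size (P i) <= m.+1)%N) -> (forall i k, `|(P i)`_k| <= M) ->
        `|curve P 0 - q| < rho ->
        forall h B, 0 < h -> h * n <= 1 ->
        (forall k : nat, (k <= m)%N -> `|u (curve P (- (k%:R * h)))| <= B) ->
        `|u (curve P h)| <= n * (B + h ^+ m.+1)].

(* [S] contains, up to [O(t^(m+1))], a polynomial curve moving at time [0] in
   the direction of increasing [j]-th coordinate. *)
Definition has_curve q rho M S : Prop := exists P : 'I_d -> {poly R},
  [/\ forall i, (size (P i) <= m.+1)%N, forall i k, `|(P i)`_k| <= M,
      `|curve P 0 - q| < rho, exists j, 0 < (P j)`_1 &
      exists C t0 : R, 0 < t0 /\ forall t, `|t| <= t0 ->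
        exists2 s, S s & `|s - curve P t| <= C * `|t| ^+ m.+1].

(** [n0] comes after [M] because the extrapolation constant depends on the bound on the
    coefficients. The ranges left to [q], [rho], [M] and [n] leave room for rational choices. *)
Lemma hypersurface_tame S p : (1 < d)%N -> (0 < m)%N -> analytic_hypersurface S -> S p ->
  exists a M0 rho0, 0 < rho0 /\ forall M, M0 <= M -> exists n0, forall q rho n,
    0 < rho -> rho <= rho0 -> `|p - q| < rho -> n0 <= n ->
    tame q rho M n a S /\ has_curve q rho M S.
Proof.
move=> d1 m0 aS Sp.
have le3 (x y z w : R) : 0 < x -> 0 < y -> 0 < z -> x + y + z <= w ->
  [/\ x <= w, y <= w & z <= w] by move=> *; split; lra.
have half_le (x y z : R) : x * y <= z + x / 2 * y -> x * y <= 2 * z by lra.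
have of_half (x y : R) : 0 < x -> y <= x / 2 -> y <= x by lra.
have near3 (x y z w v : R) : x <= y + z -> y < 2 * v -> z < v -> v <= w / 3 -> x < w by lra.
have [U [V [f [g [i [[oU oV fUV gf [af ag]] Up fS]]]]]] := aS p Sp.
pose y0 := f p.
have Vy0 : V y0 by rewrite -fUV; exists p.
have fU0 x : U x -> S x -> f x 0 i = 0.
  move=> Ux Sx; have : (f @` (U `&` S)) (f x) by exists x.
  by rewrite fS => -[].
have gS y : V y -> y 0 i = 0 -> S (g y).
  move=> Vy y_i; have : (f @` (U `&` S)) y by rewrite fS.
  by move=> [x [Ux Sx] <-]; rewrite gf.
have fg y : V y -> f (g y) = y.
  by rewrite -fUV => -[x Ux <-]; rewrite gf.
have gy0 : g y0 = p by rewrite /y0 gf.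
have [rf rf0 [cf Hf]] := analytic_has_series af Up.
have [rg rg0 [cg Hg]] := analytic_has_series ag Vy0.
have [rU rU0 HU] := ball_subset_open oU Up.
have [rV rV0 HV] := ball_subset_open oV Vy0.
have [Lf Lf0 HLf] := series_lipschitz rf0 Hf.
have [Lg Lg0 HLg] := series_lipschitz rg0 Hg.
(* [t0]: the parameters for which [y0 + t e_l] and its image are in all the balls. *)
pose t0 := Num.min (Num.min (rg / 4) (rV / 2)) (rf / 4 / Lg).
have t00 : 0 < t0 by rewrite !lt_min !divr_gt0.
have tb (t : R) : `|t| <= t0 -> [/\ `|t| <= rg / 4, `|t| < rV & Lg * `|t| <= rf / 4].
  rewrite !le_min -andbA => /and3P[h1 h2 h3]; split=> //; first by lra.
  by rewrite mulrC -ler_pdivlMr.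
have axis (l : 'I_d) t : `|y0 + t *: e_ l - y0| = `|t|.
  by rewrite addrC addKr normrZ norm_delta mulr1.
have gnear (l : 'I_d) (t : R) : `|t| <= t0 -> `|g (y0 + t *: e_ l) - p| <= Lg * `|t|.
  move=> /tb[h1 h2 h3]; rewrite -gy0 -(axis l t); apply: HLg; first by rewrite axis.
  by rewrite subrr normr0 divr_ge0// ltW.
have Vaxis (l : 'I_d) (t : R) : `|t| <= t0 -> V (y0 + t *: e_ l).
  by move=> /tb[h1 h2 h3]; apply: HV; rewrite axis.
have [Cu [Cu0 HCu]] := strict_differentiability (Hf i) rf0.
(* If all first-order coefficients vanished, the i-th coordinate of the chart would be O(t^2) at
   [g (y0 + t *: e_ i)], where it equals t. *)
have [a a0] : exists a, cf i (unit_index a) != 0.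
  apply: contrapT => nA; have A0 l : cf i (unit_index l) = 0.
    by apply: contrapT => /eqP h; apply: nA; exists l.
  apply: (@quadratic_contra (Cu * Lg * Lg) t0 t00) => t tp tt.
  have at' : `|t| = t by rewrite gtr0_norm.
  have tt' : `|t| <= t0 by rewrite at'.
  have [h1 h2 h3] := tb t tt'.
  have Lt : 0 < Lg * t by exact: mulr_gt0.
  have gn := gnear i t tt'; rewrite at' in h3 gn.
  have pp : `|p - p| <= Lg * t by rewrite subrr normr0 ltW.
  have := HCu (Lg * t) p (g (y0 + t *: e_ i)) Lt h3 pp gn.
  rewrite (fg _ (Vaxis i t tt')) big1 ?subr0 => [|l _]; last first.
    by rewrite A0 mul0r.
  have -> : (y0 + t *: e_ i) 0 i - f p 0 i = t by rewrite /y0 !mxE !eqxx mulr1; ring.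
  rewrite at' => /le_trans; apply.
  apply: le_trans (ler_wpM2l _ gn) _; first by rewrite mulr_ge0 ?ltW.
  by rewrite le_eqVlt; apply/orP; left; apply/eqP; ring.
(* A direction inside the hyperplane of the chart; this is where d >= 2 enters. *)
have [k ki] : exists k : 'I_d, k != i.
  exists (if i == Ordinal d1 then Ordinal (ltnW d1) else Ordinal d1).
  by case: (eqVneq i (Ordinal d1)) => [->//|]; rewrite eq_sym.
have Sgk t : `|t| <= t0 -> S (g (y0 + t *: e_ k)).
  move=> tt; apply: gS; first exact: Vaxis.
  by rewrite !mxE eqxx eq_sym (negbTE ki) mulr0 addr0 fU0.
have /boolp.choice[Q HQ] := fun j => axis_expansion m k (Hg j) rg0.
(* Otherwise [g] would move by O(t^2) along the k-th axis, while the Lipschitz map [f] carries this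
   motion back to one of size t. *)
have [j j0] : exists j, (Q j)`_1 != 0.
  apply: contrapT => nA; have A0 l : (Q l)`_1 = 0.
    by apply: contrapT => /eqP h; apply: nA; exists l.
  have /boolp.choice[C HC] := fun j => strict_differentiability (Hg j) rg0.
  have CC0 : 0 <= \sum_j `|C j| by exact: sumr_ge0.
  apply: (@quadratic_contra (Lf * \sum_j `|C j|) t0 t00) => t tp tt.
  have at' : `|t| = t by rewrite gtr0_norm.
  have tt' : `|t| <= t0 by rewrite at'.
  have [h1 h2 h3] := tb t tt'.
  have gt2 : `|g (y0 + t *: e_ k) - p| <= (\sum_j `|C j|) * t ^+ 2.
    apply: row_norm_le => [|j]; first by rewrite mulr_ge0// sqr_ge0.
    rewrite !mxE; have [Cj /(_ t y0 (y0 + t *: e_ k) tp)] := HC j.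
    have h1' : t <= rg / 4 by rewrite -at'.
    have a1 : `|y0 - y0| <= t by rewrite subrr normr0 ltW.
    have a2 : `|y0 + t *: e_ k - y0| <= t by rewrite axis at'.
    move=> /(_ h1' a1 a2); rewrite axis at'.
    rewrite gy0 (bigD1 k)//= big1 => [|l lk]; last first.
      by rewrite [y0 + _]addrC addrK !mxE eqxx (negbTE lk) !mulr0.
    have [_ /(_ m0) <- _ _] := HQ j.
    rewrite A0 mul0r addr0 subr0 => /le_trans; apply.
    rewrite expr2 mulrA ler_wpM2r ?(ltW tp)// ler_wpM2r ?(ltW tp)// (bigD1 j)//=.
    by rewrite (le_trans (ler_norm _))// lerDl sumr_ge0.
  have := HLf (g (y0 + t *: e_ k)) p.
  rewrite subrr normr0 => /(_ (le_trans (gnear k t tt') h3) _).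
  rewrite (fg _ (Vaxis k t tt')) axis at' => /(_ _)/le_trans; apply.
    by rewrite divr_ge0// ltW.
  by rewrite -mulrA ler_wpM2l// ltW.
(* reverse the parameter if needed to make the derivative positive *)
have [P [sP P0 Pj [C [t1 [t10 HC]]]]] : exists P : 'I_d -> {poly R},
  [/\ forall i, (size (P i) <= m.+1)%N, curve P 0 = p, 0 < (P j)`_1 &
      exists C t1 : R, 0 < t1 /\ forall t, `|t| <= t1 ->
        exists2 s, S s & `|s - curve P t| <= C * `|t| ^+ m.+1].
  have sQ l : (size (Q l) <= m.+1)%N by have [] := HQ l.
  have Q0 l : (Q l)`_0 = p 0 l by have [_ _ -> _] := HQ l; rewrite gy0.
  have /boolp.choice[C HC] : forall l, exists C : R, 0 <= C /\ forall t, `|t| <= rg / 2 ->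
      `|g (y0 + t *: e_ k) 0 l - (Q l).[t]| <= C * `|t| ^+ m.+1.
    by move=> l; have [_ _ _ [C C0 HC]] := HQ l; exists C.
  have HCg t : `|t| <= t0 ->
     `|g (y0 + t *: e_ k) - curve Q t| <= (\sum_l C l) * `|t| ^+ m.+1.
    move=> /tb[h1 h2 h3].
    have Cs0 : 0 <= \sum_l C l by apply: sumr_ge0 => l _; have [] := HC l.
    apply: row_norm_le => [|l]; first by rewrite mulr_ge0// exprn_ge0.
    rewrite !mxE; have [Cl /(_ t)] := HC l => /(_ ltac:(lra))/le_trans; apply.
    rewrite ler_wpM2r ?exprn_ge0// (bigD1 l)//= lerDl sumr_ge0// => l' _.
    by have [] := HC l'.
  have [qj|qj] := ltP 0 (Q j)`_1.
    exists Q; split=> //; first by apply/rowP => l; rewrite mxE horner_coef0 Q0.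
    exists (\sum_l C l), t0; split=> // t tt.
    by exists (g (y0 + t *: e_ k)); [exact: Sgk|exact: HCg].
  pose P l : {poly R} := \poly_(n < m.+1) ((-1) ^+ n * (Q l)`_n).
  have PE t : curve P t = curve Q (- t).
    apply/rowP => l; rewrite !mxE horner_poly (horner_coef_wide _ (sQ l)).
    by apply: eq_bigr => n _; rewrite [(- t) ^+ n]exprNn; ring.
  exists P; split.
  - by move=> l; exact: size_poly.
  - by rewrite PE oppr0; apply/rowP => l; rewrite mxE horner_coef0 Q0.
  - by rewrite coef_poly ltnS m0 expr1 mulN1r oppr_gt0 lt_neqAle j0.
  exists (\sum_l C l), t0; split=> // t tt; exists (g (y0 + (- t) *: e_ k)).
    by apply: Sgk; rewrite normrN.
  by rewrite PE -(normrN t); apply: HCg; rewrite normrN.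
pose M0 := \sum_l \sum_(n < m.+1) `|(P l)`_n|.
have M0P l (n : nat) : `|(P l)`_n| <= M0.
  have [nm|mn] := ltnP n m.+1; last first.
    rewrite nth_default ?normr0; last exact: leq_trans (sP l) mn.
    by apply: sumr_ge0 => l' _; exact: sumr_ge0.
  rewrite /M0 (bigD1 l)//= (bigD1 (Ordinal nm))//= -addrA lerDl addr_ge0 ?sumr_ge0// => l' _.
  exact: sumr_ge0.
pose A := `|cf i (unit_index a)|; have A0 : 0 < A by rewrite normr_gt0.
(* The bound A / 2 / Cu makes the error of strict differentiability at most half of the slope [A]
   along [e_ a]. *)
pose rho1 := Num.min (Num.min (rf / 8) (rU / 2)) (A / 2 / Cu).
have rho10 : 0 < rho1 by rewrite !lt_min !divr_gt0.
have /and3P[r1f r1U r1A] : [&& rho1 <= rf / 8, rho1 <= rU / 2 & rho1 <= A / 2 / Cu].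
  by rewrite -!le_min minA lexx.
(* A point within 2 rho of [q] is within 3 rho of [p]. *)
exists a, M0, (rho1 / 3); split; first by rewrite divr_gt0.
move=> M MM0; have [K K0 HK] := polynomial_curve_extrapolation m M (Hf i) rf0.
exists (Lf + 2 / A + K) => q rho n rho0 rho3 pq nn0.
have [nL nA nK] : [/\ Lf <= n, 2 / A <= n & K <= n].
  have A2 : 0 < 2 / A by rewrite divr_gt0.
  exact: le3 nn0.
have r1f4 : rho1 <= rf / 4.
  by apply: le_trans r1f _; rewrite ler_wpM2l ?(ltW rf0)// lef_pV2 ?posrE// ler_nat.
have r1U1 : rho1 <= rU by exact: of_half r1U.
have near x : `|x - q| < 2 * rho -> `|x - p| < rho1.
  move=> xq; apply: near3 xq pq rho3.
  by rewrite [ `|p - q|]distrC; exact: ler_distD.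
split; last first.
  exists P; split=> //.
  - by move=> l n'; exact: le_trans (M0P l n') MM0.
  - by rewrite P0.
  - by exists j.
  - by exists C, t1.
exists (fun x => f x 0 i); split.
- by move=> x /near xp Sx; apply: fU0 => //; apply: HU; exact: lt_le_trans xp r1U1.
- move=> x y /near xp /near yp.
  have := le_coord_norm (f x - f y) i; rewrite !mxE => /le_trans; apply.
  apply: le_trans (ler_wpM2r (normr_ge0 _) nL).
  by apply: HLf; apply: le_trans r1f4; exact: ltW.
- move=> x s /near xp /near yp.
  have := HCu rho1 x (x + s *: e_ a) rho10 r1f4 (ltW xp) (ltW yp).
  rewrite [x + s *: _ - x]addrC addKr (bigD1 a)//= big1 => [|l la]; last first.
    by rewrite !mxE eqxx (negbTE la) mulr0 mulr0.
  rewrite !mxE !eqxx mulr1 addr0 normrZ norm_delta mulr1.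
  set w := f _ 0 i - _ => h1.
  have h2 : Cu * rho1 * `|s| <= A / 2 * `|s|.
    by rewrite ler_wpM2r// mulrC -ler_pdivlMr.
  have h3 : A * `|s| <= `|w| + A / 2 * `|s|.
    have := ler_normB w (w - cf i (unit_index a) * s).
    rewrite subKr normrM => /le_trans; apply; rewrite lerD2l.
    exact: le_trans h1 h2.
  have h4 : `|s| <= 2 / A * `|w|.
    by rewrite mulrAC ler_pdivlMr// mulrC half_le.
  exact: le_trans h4 (ler_wpM2r (normr_ge0 _) nA).
- move=> P' sP' MP' P'q h B h0 hn uB.
  have B0 : 0 <= B by apply: le_trans (uB 0%N isT).
  have P'p : `|curve P' 0 - p| <= rf / 4.
    apply: le_trans r1f4; apply/ltW/near; apply: lt_le_trans P'q _.
    by rewrite mulr_natl mulr2n lerDl ltW.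
  have hK1 : h * K <= 1 by apply: le_trans hn; rewrite ler_wpM2l// ltW.
  apply: le_trans (HK P' sP' MP' P'p h B h0 hK1 uB) _.
  by rewrite ler_wpM2r// addr_ge0// exprn_ge0// ltW.
Qed.

End Tame.
End Charts.

(** * A compactly supported C^m function with a one-sided singularity *)

Section Bump.
Context {R : realType} {d : nat}.
Notation E := 'rV[R]_d.
Notation e_ i := (delta_mx 0 i : E).
Variables (m : nat) (p : E) (j : 'I_d).

(** In the variable x_l - p_l the factor lives on (-1, 1), except for l = j, where the left endpoint
    is moved to 0. *)
Definition bump_factor (l : 'I_d) (x : E) : R :=
  half_pow m ((l != j)%:R + (x 0 l - p 0 l)) * half_pow m (1 - (x 0 l - p 0 l)).

(* Compactly supported, with a singularity of order [m + 1/2] on the hyperplane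
   [x_j = p_j], to the left of which it vanishes. *)
Definition bump (x : E) : R := \prod_l bump_factor l x.

Lemma bump_reg : reg false m (fun _ : unit => bump).
Proof.
have rz l : reg false m (fun (_ : unit) (x : E) => x 0 l - p 0 l).
  by apply: regD; [exact: reg_coord|exact: (reg_cst _ (c := fun=> - p 0 l))].
apply: (@reg_prod R d false unit m _ (index_enum _) (fun l _ x => bump_factor l x)) => l.
apply: regM; apply: reg_half_pow.
  by apply: (regD (H := fun _ _ => (l != j)%:R)) => //; exact: (reg_cst _ (c := fun=> (l != j)%:R)).
apply: (regD (H := fun _ _ => 1)); first exact: (reg_cst _ (c := fun=> 1)).
exact: regN.
Qed.

Lemma bump_left (x : E) : x 0 j <= p 0 j -> bump x = 0.
Proof.
move=> xj; rewrite /bump (bigD1 j)//= /bump_factor eqxx half_pow_le0 ?mul0r//.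
by rewrite add0r subr_le0.
Qed.

Lemma bump_support (x : E) : `|p| + 1 < `|x| -> bump x = 0.
Proof.
move=> px; apply/eqP; apply: contraTT px => b0; rewrite -leNgt.
have -> : x = p + (x - p) by rewrite addrC subrK.
rewrite (le_trans (ler_normD _ _))// lerD2l; apply: row_norm_le => // l.
have : bump_factor l x != 0.
  by apply: contraNneq b0 => h; rewrite /bump (bigD1 l)//= h mul0r.
rewrite /bump_factor mulf_eq0 negb_or => /andP[h1 h2]; rewrite !mxE ler_norml.
have h1' : 0 < (l != j)%:R + (x 0 l - p 0 l).
  by rewrite ltNge; apply: contraNN h1 => h; rewrite half_pow_le0.
have h2' : 0 < 1 - (x 0 l - p 0 l).
  by rewrite ltNge; apply: contraNN h2 => h; rewrite half_pow_le0.
have : ((l != j)%:R : R) <= 1 by case: (l != j).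
by move=> ?; apply/andP; split; lra.
Qed.

(** Within 1/2 of [p], every half power except the singular one stays above a positive constant. *)
Lemma bump_right : exists2 kappa : R, 0 < kappa & forall (x : E) (s : R), `|x - p| <= 1 / 2 ->
  0 <= s -> p 0 j + s <= x 0 j -> kappa * half_pow m s <= bump x.
Proof.
pose b : R := half_pow m (1 / 2).
have b0 : 0 < b by rewrite mulr_gt0 ?exprn_gt0 ?sqrtr_gt0.
exists (b * \prod_(l | l != j) (b * b)) => [|x s xp s0 sx].
  by rewrite mulr_gt0// prodr_gt0// => l _; rewrite mulr_gt0.
have z l : `|x 0 l - p 0 l| <= 1 / 2.
  by have := le_coord_norm (x - p) l; rewrite !mxE => /le_trans; apply.
have hb l : b <= half_pow m (1 - (x 0 l - p 0 l)).
  by apply: half_pow_homo => //; have := z l; rewrite ler_norml => /andP[? ?]; lra.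
rewrite /bump [X in _ <= X](bigD1 j)//= mulrAC; apply: ler_pM.
- by rewrite mulr_ge0 ?half_pow_ge0// ltW.
- by apply: prodr_ge0 => l _; rewrite mulr_ge0// ltW.
- rewrite /bump_factor eqxx add0r mulrC ler_pM ?half_pow_ge0 ?(ltW b0)//.
  by apply: half_pow_homo => //; lra.
apply: ler_prod => l lj; rewrite mulr_ge0 ?(ltW b0)//= /bump_factor lj.
rewrite ler_pM ?(ltW b0)//; apply: half_pow_homo => //.
have -> : (true%:R : R) = 1 by [].
by have := z l; rewrite ler_norml => /andP[? ?]; lra.
Qed.

End Bump.

(** * Sheared hypersurfaces and their neighbours are not tame *)

Section Perturbation.
Context {R : realType} {d : nat}.
Notation E := 'rV[R]_d.
Notation e_ i := (delta_mx 0 i : E).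

Lemma small_multiplier (s : seq (R * R)) : (forall ab, ab \in s -> 0 < ab.2) ->
  exists2 h : R, 0 < h & forall ab, ab \in s -> h * ab.1 <= ab.2.
Proof.
elim: s => [|[a b] s IH] s0; first by exists 1.
have [|h h0 Hh] := IH; first by move=> ab abs; apply: s0; rewrite inE abs orbT.
have b0 : 0 < b by apply: (s0 (a, b)); rewrite mem_head.
have a1 : 0 < `|a| + 1 by rewrite ltr_wpDl.
exists (Num.min h (b / (`|a| + 1))); first by rewrite lt_min h0 divr_gt0.
set k := Num.min _ _.
have k0 : 0 < k by rewrite lt_min h0 divr_gt0.
have kb : k * (`|a| + 1) <= b by rewrite -ler_pdivlMr// ge_min lexx orbT.
have kh : k <= h by rewrite ge_min lexx.
move=> ab; rewrite inE => /predU1P[->|abs] /=.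
  apply: le_trans kb; rewrite ler_wpM2l ?(ltW k0)//.
  by rewrite (le_trans (ler_norm _))// lerDl.
have [a0|a0] := leP 0 ab.1; first by apply: le_trans (Hh _ abs); rewrite ler_wpM2r.
apply: le_trans (ltW (s0 ab _)); last by rewrite inE abs orbT.
by rewrite mulr_ge0_le0// ltW.
Qed.

Lemma horner_second_order (q : {poly R}) : exists2 K : R, 0 <= K &
  forall t, `|t| <= 1 -> `|q.[t] - q`_0 - q`_1 * t| <= K * t ^+ 2.
Proof.
have maj := majorant_refl_abs q.
exists (map_poly Num.norm q).[1] => [|t t1].
  have z1 : `|0 : R| <= 1 by rewrite normr0.
  by have := majorant_horner_tail 0 maj ltr01 z1; rewrite expr0 mulr1; apply: le_trans.
have := majorant_horner_tail 2 maj ltr01 t1.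
rewrite (@horner_coef_wide _ 2 (take_poly 2 q)) ?size_take_poly//.
rewrite !big_ord_recl big_ord0/= !coef_take_poly/= expr0 expr1 mulr1 addr0 divr1.
by rewrite real_normK ?num_real// opprD addrA.
Qed.

(** [psi] is built on the curve of [S0], and [delta] is fixed once [e] is, both before [S'] is
    known. [G] stands for a map carrying the sheared hypersurface into a nearby one. *)
Lemma perturbation_not_tame m q rho M n a (S0 : set E) : (0 < m)%N -> 0 < rho -> 0 <= n ->
  has_curve m q rho M S0 ->
  exists (psi : E -> R) (A : R), [/\ reg false m (fun _ : unit => psi),
    forall x, A < `|x| -> psi x = 0 &
    forall e, 0 < e -> exists2 delta : R, 0 < delta & forall (G : E -> E) (S' : set E),
      (forall x, `|G x - x| <= delta) ->
      (forall s, S0 s -> S' (G (s + (e * psi s) *: e_ a))) -> ~ tame m q rho M n a S'].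
Proof.
move=> m0 rho0 n0 [P [sP MP Pq [j Pj] [C [t0 [t00 HC]]]]].
pose p := curve P 0; pose psi := bump m p j.
exists psi, (`|p| + 1); split; [exact: bump_reg|by move=> x; exact: bump_support|].
move=> e e0.
have rpsi := reg_compact_support (bump_reg m p j) (@bump_support R d m p j).
have [L L0 psiL] := reg_lipschitz (reg_leq m0 rpsi).
have [kappa kappa0 Hkappa] := bump_right m p j.
pose f x := x + (e * psi x) *: e_ a.
pose Lf := 1 + e * L.
have Lf0 : 0 < Lf by rewrite ltr_pwDl// mulr_ge0// ltW.
have fL x y : `|f x - f y| <= Lf * `|x - y|.
  have -> : f x - f y = (x - y) + (e * (psi x - psi y)) *: e_ a.
    by rewrite /f mulrBr scalerBl; apply/rowP => i; rewrite !mxE; ring.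
  rewrite (le_trans (ler_normD _ _))// /Lf mulrDl mul1r lerD2l normrZ norm_delta mulr1.
  by rewrite normrM gtr0_norm// -mulrA ler_wpM2l ?(ltW e0)//; exact: psiL tt x y.
have fp : f p = p by rewrite /f /psi bump_left// mulr0 scale0r addr0.
have /boolp.choice[K HK] : forall l, exists K : R, 0 <= K /\ forall t, `|t| <= 1 ->
    `|(P l).[t] - (P l)`_0 - (P l)`_1 * t| <= K * t ^+ 2.
  by move=> l; have [K K0 HK] := horner_second_order (P l); exists K.
pose c1 := (P j)`_1.
pose CP := \sum_l (`|(P l)`_1| + K l).
have CPl l : `|(P l)`_1| + K l <= CP.
  rewrite /CP (bigD1 l)//= lerDl sumr_ge0// => l' _.
  by rewrite addr_ge0//; have [] := HK l'.
have CP0 : 0 <= CP.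
  by apply: sumr_ge0 => l _; rewrite addr_ge0//; have [] := HK l.
have p0 l : p 0 l = (P l)`_0 by rewrite mxE horner_coef0.
have curveP t : `|t| <= 1 -> `|curve P t - p| <= CP * `|t|.
  move=> t1; apply: row_norm_le => [|l]; first by rewrite mulr_ge0.
  rewrite !mxE (horner_coef0 (P l)); have [K0 /(_ t t1) h] := HK l.
  have t2 : t ^+ 2 <= `|t| by rewrite -real_normK ?num_real// expr2 ler_piMl.
  have := ler_normD ((P l).[t] - (P l)`_0 - (P l)`_1 * t) ((P l)`_1 * t).
  rewrite subrK => /le_trans; apply; apply: le_trans (ler_wpM2r (normr_ge0 t) (CPl l)).
  rewrite mulrDl addrC normrM lerD2l (le_trans h)// ler_wpM2l//.
pose X : R := m.+1%:R.
have X1 : 1 <= X by rewrite ler1n.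
have X0 : 0 <= X by rewrite ler0n.
(* Sheared points of the curve at times up to (m+1)h lie within W h^(m+1) of [S']: 1 accounts for
   [G], the rest for the gap between the curve and [S0], stretched by the shear. *)
pose W := 1 + Lf * (`|C| * X ^+ m.+1).
have W0 : 0 < W by rewrite ltr_pwDl// !mulr_ge0 ?exprn_ge0 ?(ltW Lf0)// (le_trans ler01).
(* [D] bounds [u] at the sheared points; [W1] and [W2] are the constants of the final inequality W1
   sqrt(c1 h / 2) h^m <= W2 h^(m+1). *)
pose D := n * W; pose W1 := e * (kappa * (c1 / 2) ^+ m); pose W2 := n * (D + n * (D + 1)).
have W10 : 0 < W1 by rewrite !mulr_gt0// exprn_gt0// divr_gt0.
have D0 : 0 <= D by rewrite mulr_ge0// ltW.
have W20 : 0 <= W2 by rewrite mulr_ge0// addr_ge0// mulr_ge0// addr_ge0.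
have [K0 HKj] := HK j.
(* The pairs with [X] alone keep the times in range, [K j * X] makes the j-th coordinate follow its
   linear part, those with [CP] or [W] keep points near [p] and [q], [n] is asked by tameness, and
   the last pair refutes the final inequality. *)
have [|h h0 Hh] := @small_multiplier [:: (X, 1); (X, t0); (K j * X, c1 / 2); (CP, 1 / 2);
    (Lf * CP * X, rho / 4); (CP, rho / 4); (W, rho / 4); (n, 1);
    (W2 ^+ 2 + 1, W1 ^+ 2 * c1 / 4)].
  move=> ab; have r4 : 0 < rho / 4 by rewrite divr_gt0.
  rewrite !inE => /or4P[/eqP->|/eqP->|/eqP->|/or4P[/eqP->|/eqP->|/eqP->|]] //=;
  by rewrite ?divr_gt0 ?mulr_gt0 ?exprn_gt0//;
    move=> /or3P[/eqP->|/eqP->|/eqP->] //=;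
    rewrite divr_gt0// mulr_gt0// exprn_gt0.
have h_X1 : h * X <= 1 by apply: (Hh (X, 1)); rewrite !inE eqxx.
have h_t0 : h * X <= t0 by apply: (Hh (X, t0)); rewrite !inE eqxx ?orbT.
have h_K : h * (K j * X) <= c1 / 2 by apply: (Hh (K j * X, c1 / 2)); rewrite !inE eqxx ?orbT.
have h_CP : h * CP <= 1 / 2 by apply: (Hh (CP, 1 / 2)); rewrite !inE eqxx ?orbT.
have h_L : h * (Lf * CP * X) <= rho / 4.
  by apply: (Hh (Lf * CP * X, rho / 4)); rewrite !inE eqxx ?orbT.
have h_CPr : h * CP <= rho / 4 by apply: (Hh (CP, rho / 4)); rewrite !inE eqxx ?orbT.
have h_W : h * W <= rho / 4 by apply: (Hh (W, rho / 4)); rewrite !inE eqxx ?orbT.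
have h_n : h * n <= 1 by apply: (Hh (n, 1)); rewrite !inE eqxx ?orbT.
have h_W2 : h * (W2 ^+ 2 + 1) <= W1 ^+ 2 * c1 / 4.
  by apply: (Hh (W2 ^+ 2 + 1, W1 ^+ 2 * c1 / 4)); rewrite !inE eqxx ?orbT.
clear Hh.
have hX : h <= h * X by rewrite ler_peMr// ltW.
have h1 : h <= 1 by exact: le_trans h_X1.
have hm0 : 0 < h ^+ m.+1 by rewrite exprn_gt0.
have hm1 : h ^+ m.+1 <= h by rewrite exprS ler_piMr ?(ltW h0)// exprn_ile1// ltW.
exists (h ^+ m.+1) => // G S' HG HS' [u [u0 uL ua uP]].
have lt_sum (x y z : R) : x <= rho / 4 + y -> y < rho -> z <= rho / 4 -> x + z < 2 * rho.
  by move: rho0; clear; lra.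
have Hu t : `|t| <= h * X ->
    `|f (curve P t) - q| < 2 * rho /\ `|u (f (curve P t))| <= D * h ^+ m.+1.
  move=> tX; have t1 : `|t| <= 1 by exact: le_trans h_X1.
  have yp : `|f (curve P t) - p| <= rho / 4.
    rewrite -{1}fp (le_trans (fL _ _))//; apply: le_trans h_L.
    apply: le_trans (ler_wpM2l (ltW Lf0) (curveP t t1)) _.
    have -> : h * (Lf * CP * X) = Lf * CP * (h * X) by ring.
    by rewrite mulrA ler_wpM2l// mulr_ge0// ltW.
  have yq : `|f (curve P t) - q| <= rho / 4 + `|p - q|.
    by rewrite (le_trans (ler_distD p _ _))// lerD2r.
  have [s Ss sP'] := HC t (le_trans tX h_t0).
  have zy : `|G (f s) - f (curve P t)| <= W * h ^+ m.+1.
    rewrite (le_trans (ler_distD (f s) _ _))// /W mulrDl mul1r lerD//.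
    rewrite (le_trans (fL _ _))// -mulrA ler_wpM2l ?(ltW Lf0)// (le_trans sP')//.
    apply: le_trans (ler_wpM2r (exprn_ge0 _ (normr_ge0 t)) (ler_norm C)) _.
    rewrite -mulrA ler_wpM2l// -exprMn lerXn2r ?nnegrE ?mulr_ge0 ?(ltW h0)//.
    by rewrite mulrC.
  have zyr : `|G (f s) - f (curve P t)| <= rho / 4.
    apply: le_trans zy _; apply: le_trans h_W; rewrite mulrC ler_wpM2r// ltW//.
  have zq : `|G (f s) - q| < 2 * rho.
    apply: le_lt_trans (ler_distD (f (curve P t)) _ _) _.
    by rewrite addrC; apply: lt_sum yq Pq zyr.
  have yq2 : `|f (curve P t) - q| < 2 * rho.
    by rewrite -[ltLHS]addr0; apply: lt_sum yq Pq _; rewrite divr_ge0// ltW.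
  split=> //.
  have := uL _ _ yq2 zq; rewrite (u0 _ zq (HS' s Ss)) subr0 => /le_trans; apply.
  by rewrite /D -mulrA ler_wpM2l// distrC.
have Pj_near t : `|t| <= 1 -> `|(P j).[t] - p 0 j - c1 * t| <= K j * t ^+ 2.
  by move=> t1; rewrite p0; exact: HKj.
(* At nonpositive times the term c1 t dominates the quadratic error, so the curve is on the side
   where the bump vanishes and the shear is the identity. *)
have left (k : nat) : (k <= m)%N -> f (curve P (- (k%:R * h))) = curve P (- (k%:R * h)) /\
    `|- (k%:R * h)| <= h * X.
  move=> km; have kh0 : 0 <= k%:R * h by rewrite mulr_ge0// ltW.
  have khX : k%:R * h <= h * X by rewrite [leRHS]mulrC ler_wpM2r ?(ltW h0)// ler_nat ltnW.
  have tX : `|- (k%:R * h)| <= h * X by rewrite normrN ger0_norm.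
  split=> //; rewrite /f /psi bump_left ?mulr0 ?scale0r ?addr0// mxE.
  have := Pj_near _ (le_trans tX h_X1); rewrite sqrrN.
  have : K j * (k%:R * h) ^+ 2 <= c1 * (k%:R * h).
    rewrite expr2 mulrA ler_wpM2r//; apply: le_trans (ler_wpM2l K0 khX) _.
    by rewrite mulrCA (le_trans h_K)// ler_pdivrMr// ler_peMr ?ler1n// ltW.
  move=> h2 /le_trans/(_ h2); rewrite mulrN opprK ler_norml => /andP[_].
  by rewrite -lerBrDr subrr subr_le0.
have uPh : `|u (curve P h)| <= n * (D * h ^+ m.+1 + h ^+ m.+1).
  apply: uP => // k km; have [fk kX] := left k km.
  by rewrite -{1}fk; have [_] := Hu _ kX.
have hh : `|h| = h by rewrite gtr0_norm.
have hhX : `|h| <= h * X by rewrite hh.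
have [yq uy] := Hu h hhX.
have cp : `|curve P h - p| <= h * CP.
  by have := curveP h; rewrite hh => /(_ h1); rewrite mulrC.
have cq : `|curve P h - q| < 2 * rho.
  apply: le_lt_trans (ler_distD p _ _) _.
  have := lt_sum (`|curve P h - p| + `|p - q|) `|p - q| 0; rewrite addr0; apply=> //.
    by rewrite lerD2r (le_trans cp).
  by rewrite divr_ge0// ltW.
(* The shear moves this point by exactly e psi along [e_ a], so e psi is bounded by a difference of
   two values of [u], both O(h^(m+1)). *)
have := ua (curve P h) (e * psi (curve P h)) cq yq.
have psi_ge : kappa * half_pow m (c1 / 2 * h) <= psi (curve P h).
  apply: Hkappa; first exact: le_trans cp h_CP.
    by rewrite mulr_ge0 ?divr_ge0 ?ltW.
  rewrite [leRHS]mxE; have := Pj_near h; rewrite hh => /(_ h1).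
  rewrite ler_norml => /andP[+ _].
  have : K j * h ^+ 2 <= c1 / 2 * h.
    rewrite expr2 mulrA ler_wpM2r ?(ltW h0)//; apply: le_trans h_K.
    by rewrite mulrC ler_wpM2l ?(ltW h0)// ler_peMr.
  by clear; lra.
have hp0 : 0 <= kappa * half_pow m (c1 / 2 * h).
  by rewrite mulr_ge0 ?half_pow_ge0// ltW.
rewrite -/(f (curve P h)) ger0_norm; last first.
  by rewrite mulr_ge0 ?(ltW e0)//; exact: le_trans psi_ge.
have ub : `|u (f (curve P h)) - u (curve P h)| <= (D + n * (D + 1)) * h ^+ m.+1.
  rewrite (le_trans (ler_normB _ _))// mulrDl lerD// (le_trans uPh)//.
  by rewrite -mulrA mulrDl mul1r.
move=> /le_trans/(_ (ler_wpM2l n0 ub)); rewrite mulrA -/W2 => final.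
have {final} : W1 * Num.sqrt (c1 / 2 * h) * h ^+ m <= W2 * h * h ^+ m.
  rewrite -[W2 * h * _]mulrA -exprS; apply: le_trans final.
  apply: le_trans (ler_wpM2l (ltW e0) psi_ge).
  by rewrite /W1 /half_pow [(c1 / 2 * h) ^+ m]exprMn le_eqVlt; apply/orP; left; apply/eqP; ring.
(* With h^m cancelled, a multiple of sqrt(h) is bounded by a multiple of h; squaring contradicts the
   choice of [h]. *)
rewrite ler_pM2r ?exprn_gt0// => sq; clearbody W1 W2.
have s0 : 0 <= c1 / 2 * h by rewrite mulr_ge0 ?divr_ge0 ?ltW.
have : (W1 * Num.sqrt (c1 / 2 * h)) ^+ 2 <= (W2 * h) ^+ 2.
  have w1 : 0 <= W1 * Num.sqrt (c1 / 2 * h) by exact: mulr_ge0 (ltW W10) (sqrtr_ge0 _).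
  have w2 : 0 <= W2 * h by exact: mulr_ge0 W20 (ltW h0).
  by rewrite lerXn2r.
rewrite !exprMn sqr_sqrtr// => sq2.
have : W1 ^+ 2 * (c1 / 2) <= W2 ^+ 2 * h.
  by rewrite -(ler_pM2r h0) -[leRHS]mulrA -expr2 -mulrA.
have W1c : 0 < W1 ^+ 2 * c1 by rewrite mulr_gt0// exprn_gt0.
move: h_W2 W1c h0; clear; set x := W2 ^+ 2; set y := W1 ^+ 2.
by move=> *; lra.
Qed.

End Perturbation.

(** * Frontiers under homeomorphisms, and rational approximation *)

Section Frontier.

Lemma frontier_homeo (T : topologicalType) (F G : T -> T) (A : set T) (x : T) :
  cancel F G -> cancel G F -> continuous F -> continuous G ->
  frontier A x -> frontier (F @` A) (F x).
Proof.
move=> FK GK cF cG [clA nA]; split.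
  move=> B /cF /clA [y [Ay By]]; exists (F y); split=> //; by exists y.
move=> iFA; apply: nA; have : nbhs x (F @^-1` (F @` A)) := cF x _ iFA.
by apply: filterS => y [z Az /(congr1 G)]; rewrite !FK => <-.
Qed.

Context {R : realType} {d : nat}.
Notation E := 'rV[R]_d.
Notation e_ i := (delta_mx 0 i : E).

(** With an empty frontier the set would be clopen; so would be its trace on a line through one of
    its points, which would then be the whole unbounded line. *)
Lemma bounded_frontier_nonempty (A : set E) : (0 < d)%N -> open A -> bounded_set A ->
  A !=set0 -> frontier A !=set0.
Proof.
move=> d0 oA bA [x Ax]; apply: contrapT => F0.
have clA : closed A.
  rewrite closure_id eqEsubset; split; first exact: subset_closure.
  move=> y cly; apply: contrapT => nAy; apply: F0; exists y.
  by split=> // /interior_subset.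
pose v := e_ (Ordinal d0); pose l (t : R) := x + t *: v.
have cl : continuous (fun t : R => x + t *: v).
  move=> t; apply: (@continuousD _ _ _ (fun=> x) (fun s : R => s *: v)).
    exact: cst_continuous.
  exact: scalel_continuous.
have conn : connected [set: R] by apply/connected_intervalP.
have lA : l @^-1` A = [set: R].
  apply: conn.
  - by exists 0; rewrite /= /l scale0r addr0.
  - by exists (l @^-1` A); rewrite ?setTI//; apply: open_comp => // t _; exact: cl.
  - by exists (l @^-1` A); rewrite ?setTI//; apply: preimage_closed => // t _; exact: cl.
have [M [_ HM]] := bA.
have MM : M < `|M| + 1 by rewrite (le_lt_trans (ler_norm M))// ltrDl.
have HA y : A y -> `|y| <= `|M| + 1 by move=> Ay; exact: (HM _ MM y Ay).
pose t := `|x| + `|M| + 2.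
have At : A (l t) by have : (l @^-1` A) t by rewrite lA.
have t0 : 0 <= t by rewrite !addr_ge0.
have := HA _ At; have := ler_normB (l t) x.
rewrite /l [x + _]addrC addrK normrZ norm_delta mulr1 ger0_norm// /t.
by have := normr_ge0 x; have := normr_ge0 M; lra.
Qed.

Lemma rational_approximation (p : E) (r : R) : 0 < r ->
  exists q : 'rV[rat]_d, `|p - map_mx ratr q| < r.
Proof.
move=> r0; have /boolp.choice[q Hq] : forall i, exists c : rat, `|p 0 i - ratr c| < r.
  move=> i; have lt : p 0 i - r < p 0 i + r by lra.
  have [c] := rat_in_itvoo lt; rewrite in_itv/= => /andP[h1 h2].
  by exists c; rewrite ltr_norml; apply/andP; split; lra.
exists (\row_i q i); apply: row_norm_lt => // i; by rewrite !mxE.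
Qed.

End Frontier.

(** * The Courant-Micheletti distance and nowhere density in the orbit *)

Section Orbit.
Context {R : realType} {d m : nat}.
Notation E := 'rV[R]_d.
Implicit Types (F : diff0 R d m) (s : seq (diff0 R d m)).

Lemma diff0_continuous F : continuous F.
Proof. by move=> x; have [] := @diff0_funC R d m F [::] isT x I. Qed.

Lemma diff0_inv_continuous F : continuous (diff0_inv F).
Proof. by move=> x; have [] := @diff0_invC R d m F [::] isT x I. Qed.

Lemma sup_euclidean_norm_ge0 (f : E -> E) :
  (0 <= ereal_sup (range (fun x => (euclidean_norm (f x))%:E)))%E.
Proof.
apply: le_ereal_sup_tmp; exists (euclidean_norm (f 0))%:E; first by exists 0.
by rewrite lee_fin sqrtr_ge0.
Qed.

Lemma Cm_norm_ge0 (f : E -> E) : (0 <= Cm_norm m f)%E.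
Proof. by apply: sume_ge0 => alpha _; exact: sup_euclidean_norm_ge0. Qed.

Lemma le_norm_Cm_norm (f : E -> E) x : (`|f x|%:E <= Cm_norm m f)%E.
Proof.
pose al0 : {ffun 'I_d -> 'I_m.+1} := [ffun=> ord0].
rewrite /Cm_norm (bigD1 al0)/=; last by rewrite big1// => i _; rewrite ffunE.
apply: (@le_trans _ _ (euclidean_norm (mderiv (fun i => al0 i : nat) f x))%:E).
  rewrite lee_fin (_ : (fun i => al0 i : nat) = fun=> 0%N) ?mderiv0 ?le_euclidean_norm//.
  by apply/funext => i; rewrite ffunE.
rewrite -[leLHS]adde0; apply: leeD.
  by apply: ereal_sup_ubound; exists x.
by apply: sume_ge0 => alpha _; exact: sup_euclidean_norm_ge0.
Qed.

Lemma cm_cost_cons F s : cm_cost (F :: s) = (cm_cost [:: F] + cm_cost s)%E.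
Proof. by rewrite /cm_cost big_cons big_seq1. Qed.

Lemma cm_cost_cat s1 s2 : cm_cost (s1 ++ s2) = (cm_cost s1 + cm_cost s2)%E.
Proof. by rewrite /cm_cost big_cat. Qed.

Lemma cm_cost_ge0 s : (0 <= cm_cost s)%E.
Proof. by apply: sume_ge0 => F _; rewrite adde_ge0 ?Cm_norm_ge0. Qed.

Lemma comp_all_cons F s x : comp_all (F :: s) x = comp_all s (F x).
Proof.
rewrite /comp_all /=.
have gen (h : E -> E) y : foldl (fun (h : E -> E) (f : diff0 R d m) => f \o h) h s y =
    foldl (fun (h : E -> E) (f : diff0 R d m) => f \o h) id s (h y).
  by elim: s h y => //= G s IH h y; rewrite IH [RHS]IH.
by rewrite gen.
Qed.

Lemma comp_all_cat s1 s2 x : comp_all (s1 ++ s2) x = comp_all s2 (comp_all s1 x).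
Proof. by elim: s1 x => [//|F s1 IH] x; rewrite cat_cons !comp_all_cons. Qed.

(** Displacements add up along a chain, and each is dominated by the order-zero term of the norm;
    this is how closeness of two domains is exploited. *)
Lemma comp_all_displacement s x : (`|comp_all s x - x|%:E <= cm_cost s)%E.
Proof.
elim: s x => [|F s IH] x; first by rewrite /comp_all /= subrr normr0 cm_cost_ge0.
rewrite comp_all_cons cm_cost_cons.
apply: (@le_trans _ _ (`|F x - x| + `|comp_all s (F x) - F x|)%:E).
  by rewrite lee_fin [leRHS]addrC; exact: ler_distD.
rewrite EFinD leeD// /cm_cost big_seq1.
apply: le_trans (le_norm_Cm_norm (fun y => F y - y) x) _.
by rewrite leeDl// Cm_norm_ge0.
Qed.

Lemma comp_all_frontier s (A : set E) x : frontier A x ->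
  frontier (comp_all s @` A) (comp_all s x).
Proof.
elim: s A x => [|F s IH] A x Ax.
  by rewrite (_ : comp_all [::] @` A = A)//; exact: image_id.
rewrite comp_all_cons (_ : comp_all (F :: s) @` A = comp_all s @` (F @` A)).
  apply: IH; apply: (@frontier_homeo _ F (diff0_inv F)) => //.
  - exact: diff0_funK.
  - exact: diff0_invK.
  - exact: diff0_continuous.
  - exact: diff0_inv_continuous.
by rewrite image_comp; congr (_ @` _); apply/funext => y; exact: comp_all_cons.
Qed.

Variable D : set E.
Implicit Types Omega : orbit_space m D.

Lemma cm_dist_le s (A B : set E) : (0 < size s)%N -> comp_all s @` A = B ->
  (cm_dist m A B <= cm_cost s)%E.
Proof. by move=> s0 AB; apply: ereal_inf_lbound; exists s. Qed.

Lemma cm_dist_lt (A B : set E) (e : R) : (cm_dist m A B < e%:E)%E ->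
  exists s, [/\ (0 < size s)%N, comp_all s @` A = B & (cm_cost s < e%:E)%E].
Proof. by move=> /ereal_inf_lt[_ [s [s0 sA] <-] se]; exists s. Qed.

(** Concatenation of chains gives the triangle inequality; the first chain has finite cost, which
    leaves a positive real margin. *)
Lemma cm_ball_open Omega (e : R) :
  open [set Omega' : orbit_space m D | (cm_dist m (sval Omega) (sval Omega') < e%:E)%E].
Proof.
move=> W1 /= /cm_dist_lt[s1 [s10 s1A c1]].
have c1f : cm_cost s1 \is a fin_num.
  by rewrite ge0_fin_numE ?cm_cost_ge0// (lt_trans c1)// ltry.
exists (e - fine (cm_cost s1)); first by rewrite subr_gt0 -lte_fin fineK.
move=> W2 /cm_dist_lt[s2 [s20 s2A c2]].
apply: le_lt_trans (_ : (cm_cost (s1 ++ s2) < e%:E)%E).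
  apply: cm_dist_le; first by rewrite size_cat addn_gt0 s10.
  rewrite -s2A -s1A image_comp; congr (_ @` _); apply/funext => x; exact: comp_all_cat.
rewrite cm_cost_cat -(fineK c1f).
have -> : e = fine (cm_cost s1) + (e - fine (cm_cost s1)) by ring.
by rewrite EFinD lteD2lE.
Qed.

(** Chains are non-empty, so an element equal to the identity must be exhibited: the shear with zero
    profile. *)
Lemma cm_dist_refl (A : set E) (e : R) : (0 < m)%N -> (0 < d)%N -> 0 < e ->
  (cm_dist m A A < e%:E)%E.
Proof.
move=> m0 d0 e0.
have rpsi : reg false m (fun (_ : unit) (_ : E) => 0 : R) by exact: (reg_cst _ (c := fun=> 0)).
have [eps _ [F [FE Fcost _]]] :=
  small_shear (Ordinal d0) (A := 0) m0 rpsi (fun _ _ => erefl) e0.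
apply: le_lt_trans Fcost; apply: cm_dist_le => //.
rewrite (_ : comp_all [:: F] = id) ?image_id//; apply/funext => x.
by rewrite comp_all_cons FE mulr0 scale0r addr0.
Qed.

(** Perturbing members of [F] is enough, since an open set inside the closure of [F] contains one.
    The ball around [W1] that avoids [F] then contradicts that [W1] is in the closure. *)
Lemma nowhere_dense_orbit (F : set (orbit_space m D)) : (0 < m)%N -> (0 < d)%N ->
  (forall Omega (e : R), F Omega -> 0 < e -> exists2 W1 : orbit_space m D,
     (cm_dist m (sval Omega) (sval W1) < e%:E)%E & exists2 delta : R, 0 < delta &
     forall W2 : orbit_space m D, F W2 ->
       ~ (cm_dist m (sval W1) (sval W2) < delta%:E)%E) ->
  nowhere_dense F.
Proof.
move=> m0 d0 HF; rewrite /nowhere_dense -subset0 => Omega iO.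
have [W0 [FO0 iO0]] : nonempty (F `&` interior (closure F)).
  by apply: (interior_subset iO); apply: open_nbhs_nbhs; split=> //; exact: open_interior.
have /(_ _ iO0)[e e0 se] := open_interior (closure F).
have [W1 d01 [delta delta0 far]] := HF _ e FO0 e0.
have clO1 : closure F W1 by apply: interior_subset; exact: se.
have [W2 [FO2 d12]] : nonempty (F `&`
    [set W : orbit_space m D | (cm_dist m (sval W1) (sval W) < delta%:E)%E]).
  apply: clO1; apply: open_nbhs_nbhs; split; first exact: cm_ball_open.
  exact: cm_dist_refl.
exact: far FO2 d12.
Qed.

End Orbit.

Theorem theorem1p3 (R : realType) (d m : nat) (hd : (2 <= d)%N) (hm : (3 <= m)%N)
    (D : set 'rV[R]_d) (D0 : D !=set0) (Dbounded : bounded_set D)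
    (Dconnected : connected D) (Dopen : open D) (DCm : of_class_Cm m D) :
  meager [set Omega : orbit_space m D |
            analytic_hypersurface (frontier (sval Omega))].
Proof.
have m0 : (0 < m)%N by exact: leq_trans hm.
(* A rational centre, a direction, and three naturals: one for the radius, one for the coefficient
   bound [M], one for the constant [n]. *)
pose index : countType := ('rV[rat]_d * 'I_d * (nat * nat * nat))%type.
pose center (i : index) : 'rV[R]_d := map_mx ratr i.1.1.
pose rho (i : index) : R := i.2.1.1.+1%:R^-1.
have rho0 i : 0 < rho i by rewrite invr_gt0 ltr0n.
pose A := [set Omega : orbit_space m D | analytic_hypersurface (frontier (sval Omega))].
(* The conjunct [A Omega] makes the union equal to [A], as [meager] asks for an equality. *)
pose Fi (i : index) := [set Omega : orbit_space m D |
  [/\ A Omega, tame m (center i) (rho i) i.2.1.2%:R i.2.2%:R i.1.2 (frontier (sval Omega)) &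
      has_curve m (center i) (rho i) i.2.1.2%:R (frontier (sval Omega))]].
pose F (k : nat) := if (choice.unpickle k : option index) is Some i then Fi i else set0.
exists F; last first.
  rewrite eqEsubset; split=> [W aO|W [k _]]; last first.
    by rewrite /F; case: choice.unpickle => // i [].
  have [p Fp] : frontier (sval W) !=set0.
    case: (svalP W) => f ->.
    have [p Dp] := bounded_frontier_nonempty (ltnW hd) Dopen Dbounded D0.
    exists (f p); apply: (@frontier_homeo _ f (diff0_inv f)) => //.
    - exact: diff0_funK.
    - exact: diff0_invK.
    - exact: diff0_continuous.
    - exact: diff0_inv_continuous.
  have [a [M0 [rho1 [rho10 HM]]]] := hypersurface_tame hd m0 aO Fp.
  (* The real bounds are rounded up to naturals, and the centre is approximated within the rounded
     radius, so that [p] stays in the ball. *)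
  pose M := Num.truncn `|M0|.
  have [n0 Hn0] := HM M.+1%:R (le_trans (ler_norm M0) (ltW (truncnS_gt _))).
  pose N := Num.truncn (rho1^-1).
  have NN : N.+1%:R^-1 <= rho1.
    rewrite -[leRHS]invrK lef_pV2 ?posrE ?invr_gt0 ?ltr0n//; exact/ltW/truncnS_gt.
  have Np : 0 < N.+1%:R^-1 :> R by rewrite invr_gt0 ltr0n.
  have [q Hq] := rational_approximation p Np.
  pose n := (Num.truncn `|n0|).+1.
  have nn0 : n0 <= n%:R := le_trans (ler_norm n0) (ltW (truncnS_gt _)).
  have [tO cO] := Hn0 _ _ _ Np NN Hq nn0.
  exists (choice.pickle ((q, a, (N, M.+1, n)) : index)); first exact: I.
  by rewrite /F choice.pickleK.
move=> k; rewrite /F; case: choice.unpickle => [i|]; last first.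
  by rewrite /nowhere_dense closure0 interior0.
apply: nowhere_dense_orbit => //; first exact: ltnW.
move=> Omega e [aO tO cO] e0.
have [psi [B [rpsi psi0 Hpsi]]] :=
  perturbation_not_tame i.1.2 m0 (rho0 i) (ler0n R i.2.2) cO.
have [eps eps0 [P [PE Pcost PG]]] := small_shear i.1.2 m0 rpsi psi0 e0.
have [delta delta0 far] := Hpsi eps eps0.
have orb : orbit0 m D (P @` sval Omega).
  have [G ->] := svalP Omega; have [H HE] := PG G.
  by exists H; rewrite image_comp; congr (_ @` _); apply/funext => x; rewrite HE.
exists (exist _ _ orb : orbit_space m D) => /=.
  apply: le_lt_trans Pcost; apply: cm_dist_le => //.
exists delta => // W2 [_ tO2 _] /cm_dist_lt[s [_ sE sc]].
(* The chain from the sheared domain to [W2] plays the part of [G]; its cost, below [delta], bounds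
   the displacement. *)
apply: (far (comp_all s) (frontier (sval W2))) tO2.
  move=> x; rewrite -lee_fin; apply: le_trans (ltW sc); exact: comp_all_displacement.
move=> x fx; rewrite -PE -sE; apply: comp_all_frontier.
apply: (@frontier_homeo _ P (diff0_inv P)) => //.
- exact: diff0_funK.
- exact: diff0_invK.
- exact: diff0_continuous.
- exact: diff0_inv_continuous.
Qed.
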